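(* Let $p$ be a prime, $r\in\mathbb{Z}_+$, $a=(a_0,a_1,\dots)\in\Delta_p$, and let $\eta$ be a Lévy measure on $\Delta_p$. For $n\in\mathbb{Z}_+$ let $\eta_{n+1}$ be the measure on $\mathbb{Z}^{n+1}$ defined by $\eta_{n+1}(\{0\}):=0$ and $$\eta_{n+1}(\{\ell\}):=\eta(\{x\in\Delta_p:(x_0,x_1,\dots,x_n)=\ell\})\qquad\text{for all }\ell\in\mathbb{Z}^{n+1}\setminus\{0\}.$$ Then there exist integer-valued random variables $U_0,U_1,\dots$ and $Y_0,Y_1,\dots$ such that - $U_0,U_1,\dots$ are independent of each other and of the sequence $Y_0,Y_1,\dots$; - $U_0=\dots=U_{r-1}=0$, and $U_r,U_{r+1},\dots$ are uniformly distributed on $\{0,1,\dots,p-1\}$; - for all $n\in\mathbb{Z}_+$, the distribution of $(Y_0,\dots,Y_n)$ is the compound Poisson measure $\mathrm{e}(\eta_{n+1})$ on $\mathbb{Z}^{n+1}$; and for any such random variables, the $\Delta_p$-valued random element $\varphi(U_0+a_0+Y_0,\,U_1+a_1+Y_1,\dots)$ has distribution $$\omega_{\Lambda_r}*\delta_a*\pi_{\eta,\,g_{\Delta_p}}.$$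
   Context: $\mathbb{Z}_+$ is the set of nonnegative integers. The group of $p$-adic integers is $\Delta_p:=\{(x_0,x_1,\dots): x_j\in\{0,1,\dots,p-1\}\text{ for all }j\in\mathbb{Z}_+\}$, where the sum $z=x+y$ is uniquely determined by $\sum_{j=0}^d z_jp^j\equiv\sum_{j=0}^d(x_j+y_j)p^j \pmod{p^{d+1}}$ for all $d\in\mathbb{Z}_+$. For $r\in\mathbb{Z}_+$, $\Lambda_r:=\{x\in\Delta_p:x_j=0\text{ for all }j\le r-1\}$, a compact subgroup; the sets $x+\Lambda_r$ ($x\in\Delta_p$, $r\in\mathbb{Z}_+$) form an open subbasis of the topology of $\Delta_p$, which is a compact Abelian group. Its identity is denoted by $e$. Characters are continuous homomorphisms into $\mathbb{T}=\{z\in\mathbb{C}:|z|=1\}$; the character group is $\widehat{\Delta}_p=\{\chi_{d,\ell}:d\in\mathbb{Z}_+,\ \ell=0,1,\dots,p^{d+1}-1\}$, $\chi_{d,\ell}(x)=\mathrm{e}^{2\pi i\ell(x_0+px_1+\cdots+p^dx_d)/p^{d+1}}$. The map $\varphi:\mathbb{Z}^\infty\to\Delta_p$, where $\mathbb{Z}^\infty$ is the group of integer sequences $(y_0,y_1,\dots)$ with the product topology, is uniquely defined by $\sum_{j=0}^d y_jp^j\equiv\sum_{j=0}^d\varphi(y)_jp^j\pmod{p^{d+1}}$ for all $d\in\mathbb{Z}_+$; it is a continuous homomorphism onto $\Delta_p$. Measures are Borel measures. A measure $\eta$ on $\Delta_p$ with values in $[0,+\infty]$ is a Lévy measure if and only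 if $\eta(\{e\})=0$ and $\eta(\Delta_p\setminus\Lambda_r)<\infty$ for all $r\in\mathbb{Z}_+$. With the local inner product $g_{\Delta_p}=0$, the generalized Poisson measure $\pi_{\eta,\,g_{\Delta_p}}$ is the probability measure on $\Delta_p$ whose Fourier transform is $\int_{\Delta_p}\chi\,\mathrm{d}\pi_{\eta,\,g_{\Delta_p}}=\exp\{\int_{\Delta_p}(\chi(x)-1)\,\mathrm{d}\eta(x)\}$ for all $\chi\in\widehat{\Delta}_p$. $\omega_{\Lambda_r}$ is the Haar measure of $\Lambda_r$ normalized by $\omega_{\Lambda_r}(\Lambda_r)=1$ and regarded as a measure on $\Delta_p$, $\delta_a$ is the Dirac measure at $a$, and $*$ is convolution. For a bounded measure $\nu$ on a locally compact Abelian group $G$ with identity $e_G$, the compound Poisson measure is $\mathrm{e}(\nu):=\mathrm{e}^{-\nu(G)}\big(\delta_{e_G}+\nu+\frac{\nu*\nu}{2!}+\frac{\nu*\nu*\nu}{3!}+\cdots\big)$. *)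

(* Defs.v *)
From HB Require Import structures.
From mathcomp Require Import all_boot all_order all_algebra finmap.
From mathcomp Require Import all_classical all_reals all_analysis.
From mathcomp.real_closed Require Import complex.
From mathcomp Require Import ring.

Set Implicit Arguments.
Unset Strict Implicit.
Unset Printing Implicit Defensive.

Import Order.TTheory GRing.Theory Num.Theory.

Local Open Scope classical_set_scope.
Local Open Scope ring_scope.

(* The group law [add] and its identity [e] are explicit: the hierarchy has no
   structure joining measurable types and Abelian groups.  Measures are passed
   as set functions, as in the library's product [\x], so that convolutions can
   be iterated without first being packaged as measures. *)
Definition convolution (R : realType) d (G : measurableType d)
    (add : G -> G -> G) (mu nu : set G -> \bar R) : set G -> \bar R :=
  pushforward (mu \x nu)%E (fun z : G * G => add z.1 z.2).

Definition convolution_power (R : realType) d (G : measurableType d)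
    (add : G -> G -> G) (e : G) (nu : set G -> \bar R) (k : nat) :
    set G -> \bar R :=
  iter k (convolution add nu) (\d_e).

Definition compound_poisson (R : realType) d (G : measurableType d)
    (add : G -> G -> G) (e : G) (nu : set G -> \bar R) (A : set G) : \bar R :=
  ((expR (- fine (nu setT)))%:E *
   \sum_(0 <= k <oo) ((k`!%:R)^-1)%:E * convolution_power add e nu k A)%E.

Definition is_normalized_haar (R : realType) d (G : measurableType d)
    (add : G -> G -> G) (H : set G) (mu : probability G R) : Prop :=
  mu H = 1%E /\
  forall h, H h -> forall A, measurable A -> mu [set add h x | x in A] = mu A.

Definition cintegral (R : realType) d (T : measurableType d)
    (mu : {measure set T -> \bar R}) (f : T -> R[i]) : R[i] :=
  Complex (\int[mu]_x complex.Re (f x)) (\int[mu]_x complex.Im (f x)).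

Definition cexp (R : realType) (z : R[i]) : R[i] :=
  let: Complex a b := z in Complex (expR a * cos b) (expR a * sin b).

Definition independent (R : realType) d (T : measurableType d)
    (P : probability T R) (I : choiceType) (F : I -> set (set T)) : Prop :=
  forall (J : {fset I}) (E : I -> set T),
    (forall i, i \in J -> F i (E i)) ->
    P (\bigcap_(i in [set` J]) E i) = (\prod_(i <- J) P (E i))%E.

Definition sigma_generated d d' (T : measurableType d) (T' : measurableType d')
    (X : T -> T') : set (set T) :=
  preimage_set_system setT X measurable.

Definition sigma_generated_seq d d' (T : measurableType d)
    (T' : measurableType d') (X : nat -> T -> T') : set (set T) :=
  <<s \bigcup_n sigma_generated (X n) >>.

Definition has_law (R : realType) d d' (T : measurableType d)
    (T' : measurableType d') (P : probability T R) (X : T -> T')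
    (mu : set T' -> \bar R) : Prop :=
  measurable_fun setT X /\
  forall A, measurable A -> P (X @^-1` A) = mu A.

HB.instance Definition _ := isPointed.Build int 0.

HB.instance Definition _ := @isMeasurable.Build default_measure_display
  int discrete_measurable discrete_measurable0
  discrete_measurableC discrete_measurableU.

HB.instance Definition _ (n : nat) :=
  @isMeasurable.Build default_measure_display
  'rV[int]_n discrete_measurable discrete_measurable0
  discrete_measurableC discrete_measurableU.

(* The primality proof is a parameter of the type so that the group structure
   can be a canonical instance. *)
Record padic (p : nat) (p_pr : prime p) := Padic { digit :> nat -> 'I_p }.

Lemma padic_ext p (p_pr : prime p) (x y : padic p_pr) : x =1 y -> x = y.
Proof. by case: x => x; case: y => y /= /funext ->. Qed.

HB.instance Definition _ p (p_pr : prime p) := gen_eqMixin (padic p_pr).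
HB.instance Definition _ p (p_pr : prime p) := gen_choiceMixin (padic p_pr).

Definition partial_sum (p : nat) (y : nat -> int) (d : nat) : int :=
  \sum_(j < d) y j * p%:Z ^+ j.

Lemma phi_digit_subproof p (p_pr : prime p) (m : int) :
  (`|(m %% p%:Z)%Z| < p)%N.
Proof.
have p0 := prime_gt0 p_pr.
have := @ltz_pmod m p%:Z p0; have : (0 <= m %% p%:Z)%Z by rewrite modz_ge0// -lt0n.
by case: (m %% p%:Z)%Z.
Qed.

(* The base-p digit of index d of the sum of y_j p^j over j <= d. *)
Definition phi (p : nat) (p_pr : prime p) (y : nat -> int) : padic p_pr :=
  Padic p_pr (fun d => Ordinal
    (phi_digit_subproof p_pr (partial_sum p y d.+1 %/ (p ^ d)%N%:Z)%Z)).

Lemma partial_sumS p y d :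
  partial_sum p y d.+1 = partial_sum p y d + y d * p%:Z ^+ d.
Proof. by rewrite /partial_sum big_ord_recr. Qed.

Section Phi.
Context (p : nat) (p_pr : prime p).
Implicit Types (x : padic p_pr) (y : nat -> int).

Let pX d : (p ^ d)%N%:Z = p%:Z ^+ d.
Proof. by elim: d => // d IH; rewrite expnS exprS PoszM IH. Qed.

Let pX_gt0 d : 0 < p%:Z ^+ d.
Proof. by rewrite exprn_gt0// ltz_nat prime_gt0. Qed.

Let carry_lt (m q : int) d :
  0 <= m < p%:Z ^+ d -> 0 <= q < p%:Z ->
  0 <= m + q * p%:Z ^+ d < p%:Z ^+ d.+1.
Proof.
move=> /andP[m0 md] /andP[q0 qp]; apply/andP; split.
  by rewrite addr_ge0// mulr_ge0// ltW.
rewrite exprS; apply: (@lt_le_trans _ _ ((q + 1) * p%:Z ^+ d)).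
  by rewrite mulrDl mul1r addrC ltrD2l.
by rewrite ler_pM2r// lezD1.
Qed.

Lemma partial_sum_phi y d :
  partial_sum p (fun j => Posz (phi p_pr y j)) d =
  (partial_sum p y d %% p%:Z ^+ d)%Z.
Proof.
elim: d => [|d IH]; first by rewrite /partial_sum !big_ord0 mod0z.
rewrite [LHS]partial_sumS IH /= pX gez0_abs ?modz_ge0//; last first.
  by rewrite eq_sym lt_eqF// ltz_nat prime_gt0.
set S := partial_sum p y d.+1.
have -> : (partial_sum p y d %% p%:Z ^+ d)%Z = (S %% p%:Z ^+ d)%Z.
  by rewrite /S partial_sumS addrC modzMDl.
set q := (S %/ p%:Z ^+ d)%Z; set m := (S %% p%:Z ^+ d)%Z.
have m_lt : 0 <= m < p%:Z ^+ d by rewrite modz_ge0 ?ltz_pmod ?lt0r_neq0.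
have q_lt : 0 <= (q %% p%:Z)%Z < p%:Z.
  by rewrite modz_ge0 ?ltz_pmod ?lt0r_neq0 ?ltz_nat ?prime_gt0.
have -> : S = (q %/ p%:Z)%Z * p%:Z ^+ d.+1 + (m + (q %% p%:Z)%Z * p%:Z ^+ d).
  by rewrite [LHS](divz_eq S (p%:Z ^+ d)) -/q -/m {1}(divz_eq q p%:Z) exprS; ring.
by rewrite modzMDl [RHS]modz_small ?carry_lt.
Qed.

Lemma phiP y d :
  (partial_sum p y d.+1 =
   partial_sum p (fun j => Posz (phi p_pr y j)) d.+1 %[mod p%:Z ^+ d.+1])%Z.
Proof. by rewrite partial_sum_phi modz_mod. Qed.

Lemma partial_sum_inj x x' :
  (forall d, partial_sum p (fun j => Posz (x j)) d =
             partial_sum p (fun j => Posz (x' j)) d) -> x = x'.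
Proof.
move=> H; apply: padic_ext => d; apply/val_inj.
have := H d.+1; rewrite !partial_sumS H => /addrI /mulIf.
by rewrite lt0r_neq0// => /(_ isT) [].
Qed.

Lemma phi_digits x : phi p_pr (fun j => Posz (x j)) = x.
Proof.
apply: partial_sum_inj => d; rewrite partial_sum_phi modz_small//.
elim: d => [|d IH]; first by rewrite /partial_sum big_ord0.
by rewrite partial_sumS; apply: carry_lt => //; rewrite lez_nat ltz_nat /=.
Qed.

Lemma eq_phi y y' : (forall d,
    (partial_sum p y d = partial_sum p y' d %[mod p%:Z ^+ d])%Z) ->
  phi p_pr y = phi p_pr y'.
Proof.
by move=> H; apply: partial_sum_inj => d; rewrite !partial_sum_phi H.
Qed.

(* The characterization defining phi has only one solution. *)
Lemma phi_unique y x : (forall d,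
    (partial_sum p y d.+1 =
     partial_sum p (fun j => Posz (x j)) d.+1 %[mod p%:Z ^+ d.+1])%Z) ->
  phi p_pr y = x.
Proof.
move=> H; rewrite -[RHS]phi_digits; apply: eq_phi => -[|d]; last exact: H.
by rewrite /partial_sum !big_ord0.
Qed.

Lemma phiDl y y' :
  phi p_pr (fun j => Posz (phi p_pr y j) + y' j) = phi p_pr (fun j => y j + y' j).
Proof.
have D f g d : partial_sum p (fun j => f j + g j) d =
    partial_sum p f d + partial_sum p g d.
  by rewrite /partial_sum -big_split; apply: eq_bigr => j _; rewrite mulrDl.
by apply: eq_phi => d; rewrite !D partial_sum_phi modzDml.
Qed.

End Phi.

(* The sum z = x + y is the one with
   sum_(j <= d) z_j p^j = sum_(j <= d) (x_j + y_j) p^j  mod p^(d+1). *)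
Definition padic_add p (p_pr : prime p) (x y : padic p_pr) : padic p_pr :=
  phi p_pr (fun j => Posz (x j) + Posz (y j)).

Definition padic_opp p (p_pr : prime p) (x : padic p_pr) : padic p_pr :=
  phi p_pr (fun j => - Posz (x j)).

Definition padic_zero p (p_pr : prime p) : padic p_pr :=
  Padic p_pr (fun=> Ordinal (prime_gt0 p_pr)).

Lemma padic_addC p (p_pr : prime p) : commutative (@padic_add p p_pr).
Proof.
by move=> x y; congr phi; apply/funext => j; rewrite addrC.
Qed.

Lemma padic_addA p (p_pr : prime p) : associative (@padic_add p p_pr).
Proof.
move=> x y z; rewrite padic_addC /padic_add !phiDl.
by congr phi; apply/funext => j; rewrite addrC addrA.
Qed.

Lemma padic_add0 p (p_pr : prime p) :
  left_id (padic_zero p_pr) (@padic_add p p_pr).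
Proof.
move=> x; rewrite -[RHS]phi_digits.
by congr phi; apply/funext => j; rewrite add0r.
Qed.

Lemma padic_addN p (p_pr : prime p) :
  left_inverse (padic_zero p_pr) (@padic_opp p p_pr) (@padic_add p p_pr).
Proof.
move=> x; rewrite /padic_add phiDl -[RHS]phi_digits.
by congr phi; apply/funext => j; rewrite addNr.
Qed.

HB.instance Definition _ p (p_pr : prime p) :=
  GRing.isZmodule.Build (padic p_pr)
  (@padic_addA p p_pr) (@padic_addC p p_pr)
  (@padic_add0 p p_pr) (@padic_addN p p_pr).

HB.instance Definition _ p (p_pr : prime p) :=
  isPointed.Build (padic p_pr) 0.

Lemma phiD p (p_pr : prime p) (y y' : nat -> int) :
  phi p_pr (fun j => y j + y' j) = phi p_pr y + phi p_pr y'.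
Proof.
rewrite -phiDl; under eq_fun do rewrite addrC; rewrite -phiDl.
by congr phi; apply/funext => j; rewrite addrC.
Qed.

Definition Lambda p (p_pr : prime p) (r : nat) : set (padic p_pr) :=
  [set x : padic p_pr | forall j, (j < r)%N -> x j = 0%N :> nat].
Arguments Lambda {p} p_pr r _.

HB.instance Definition _ p (p_pr : prime p) :=
  @isSubBaseTopological.Build (padic p_pr) (padic p_pr * nat)%type setT
  (fun i => [set i.1 + l | l in Lambda p_pr i.2]).

Lemma padic_borelC p (p_pr : prime p) (A : set (padic p_pr)) :
  <<s open >> A -> <<s open >> (~` A).
Proof. by move=> sA; rewrite -setTD; exact: sigma_algebraCD. Qed.

HB.instance Definition _ p (p_pr : prime p) :=
  @isMeasurable.Build (sigma_display (@open (padic p_pr)))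
  (padic p_pr) <<s @open (padic p_pr) >>
  (@sigma_algebra0 _ setT (@open (padic p_pr))) (@padic_borelC p p_pr)
  (@sigma_algebra_bigcup _ setT (@open (padic p_pr))).

Section Measures.
Context (R : realType) (p : nat) (p_pr : prime p).
Local Notation Delta := (padic p_pr).

Definition padic_convolution (mu nu : set Delta -> \bar R) :
    set Delta -> \bar R :=
  @convolution R _ Delta +%R mu nu.

(* The first argument of [xget] here and below is only its default value. *)
Definition haar_measure (H : set Delta) : probability Delta R :=
  xget (\d_(0 : Delta) : probability Delta R) (@is_normalized_haar R _ Delta +%R H).

Definition is_character (chi : Delta -> R[i]) : Prop :=
  [/\ continuous (chi : Delta -> R[i]^o),
      forall x, `|chi x| = 1 &
      forall x y, chi (x + y) = chi x * chi y].

Definition is_levy_measure (eta : {measure set Delta -> \bar R}) : Prop :=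
  eta [set 0] = 0%E /\ forall r, (eta (~` Lambda p_pr r) < +oo)%E.

Definition is_generalized_poisson (eta : {measure set Delta -> \bar R})
    (mu : probability Delta R) : Prop :=
  forall chi, is_character chi ->
    cintegral mu chi = cexp (cintegral eta (fun x => chi x - 1)).

(* The probability measure with the above Fourier transform, the local inner
   product being 0. *)
Definition generalized_poisson (eta : {measure set Delta -> \bar R}) :
    probability Delta R :=
  xget (\d_(0 : Delta) : probability Delta R) (is_generalized_poisson eta).

(* Z^n is countable and discrete, so the measure is the sum of its point masses. *)
Definition levy_projection (eta : {measure set Delta -> \bar R}) (n : nat)
    (A : set 'rV[int]_n) : \bar R :=
  \esum_(l in A) (if l == 0 then 0%E
                  else eta [set x : Delta | forall j : 'I_n, Posz (x j) = l 0 j]).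

Definition admissible (r : nat) (eta : {measure set Delta -> \bar R})
    d (T : measurableType d) (P : probability T R)
    (U Y : nat -> {RV P >-> int}) : Prop :=
  [/\ independent P (fun i : option nat =>
        if i is Some j then sigma_generated (U j)
        else sigma_generated_seq Y),
      forall j, (j < r)%N -> forall t, U j t = 0,
      forall j, (r <= j)%N -> forall k, (k < p)%N ->
        P (U j @^-1` [set Posz k]) = ((p%:R)^-1)%:E &
      forall n, has_law P (fun t => \row_(j < n.+1) Y j t)
        (@compound_poisson R _ 'rV[int]_n.+1 +%R 0
          (@levy_projection eta n.+1))].

End Measures.

(* Main.v *)
From HB Require Import structures.
Require Import Defs.
From mathcomp Require Import all_boot all_order all_algebra finmap.
From mathcomp Require separable cyclotomic.
From mathcomp Require Import all_classical all_reals all_analysis.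
From mathcomp Require Import measurable_realfun.
From mathcomp.real_closed Require Import complex.
From mathcomp Require Import ring lra.

(* The residue of x in Delta_p mod p^(d+1) is a homomorphism to Z/p^(d+1) whose
   fibres are the cosets of Lambda_(d+1).  These fibres generate the Borel
   sigma-algebra, and a continuous character factors through such a residue, as
   the unit circle has no small subgroups; so a probability measure is determined
   by its Fourier transform because a polynomial of degree < N vanishing at all
   N-th roots of unity is 0.
   - Pushing e(eta_(n+1)) to Z/p^(n+1) turns convolution powers into powers of
     finite Fourier sums, so the law of phi(Y) has the Fourier transform of
     pi_eta.
   - The law of phi(U) gives cylinders their Haar mass; two Haar measures mu, nu
     agree because both equal the integral of mu(A - y) d nu(y).
   - phi is a homomorphism, so phi(U + a + Y) = phi(U) + a + phi(Y), with phi(U)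
     and phi(Y) independent.
   For existence, the laws e(eta_n) are consistent: eta_(n+1) projects to eta_n
   plus a finite mass at 0, to which the compound Poisson measure is blind.  Any
   consistent family of discrete laws is realized on [0,1[ by nested intervals. *)

Import Order.TTheory GRing.Theory Num.Theory.
Import numFieldNormedType.Exports.

Set Implicit Arguments.
Unset Strict Implicit.
Unset Printing Implicit Defensive.

Local Open Scope classical_set_scope.
Local Open Scope ring_scope.

(** * Cylinders and Borel sets of the p-adic integers *)

Section Padic.
Context (p : nat) (p_pr : prime p).
Local Notation Delta := (padic p_pr).
Implicit Types (x y c : Delta) (d : nat).

(** [haar_measure] and [generalized_poisson] are picked by [xget], so nothing is known about them
    until some measure with the defining property is exhibited. The laws of phi(U) and phi(Y) serve
    as these witnesses, and the uniqueness results then identify the chosen measures with them. The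
    obstacle is that [eta] may have infinite mass near 0, so that there is no compound Poisson
    measure of [eta] on Delta_p to work with. Every computation therefore takes place at a finite
    level n: outside Lambda_n the mass is finite, and on a small enough Lambda_n the integrand chi -
    1 vanishes. As [cexp] is built from the real [expR], [cos] and [sin], the complex exponential
    series has to be identified with it before the series of convolution powers can be summed. *)

Definition psum x d : int := partial_sum p (fun j => Posz (x j)) d.

Let pX_gt0 d : 0 < p%:Z ^+ d.
Proof. by rewrite exprn_gt0// ltz_nat prime_gt0. Qed.

Lemma psum_mod x d : (psum x d %% p%:Z ^+ d)%Z = psum x d.
Proof. by rewrite -(@partial_sum_phi p p_pr) phi_digits. Qed.

Lemma psumD x y d : psum (x + y) d = ((psum x d + psum y d) %% p%:Z ^+ d)%Z.
Proof.
rewrite /psum partial_sum_phi /partial_sum -big_split /=; congr (_ %% _)%Z.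
by apply: eq_bigr => j _; rewrite mulrDl.
Qed.

Lemma psum_inj x y d : psum x d = psum y d <-> forall j, (j < d)%N -> x j = y j.
Proof.
split; last first.
  move=> H; apply: eq_bigr => -[j jd] _ /=; by rewrite H.
elim: d => [|d IH]; first by [].
move=> H; have H1 : psum x d = psum y d.
  (* Reduction mod p^d removes the top digit. *)
  rewrite -(psum_mod x d) -(psum_mod y d).
  have : (psum x d.+1 %% p%:Z ^+ d = psum y d.+1 %% p%:Z ^+ d)%Z by rewrite H.
  rewrite /psum !partial_sumS.
  by rewrite addrC modzMDl addrC modzMDl.
move=> j; rewrite ltnS leq_eqVlt => /orP[/eqP ->|]; last exact: IH.
move: H; rewrite /psum !partial_sumS -/(psum x d) -/(psum y d) H1 => /addrI /mulIf.
by rewrite lt0r_neq0// => /(_ isT) [] /val_inj.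
Qed.

Definition cyl d c : set Delta := [set x | forall j, (j < d)%N -> x j = c j].

Lemma cylE d c x : cyl d c x <-> psum x d = psum c d.
Proof. by split => /psum_inj. Qed.

Lemma psum0 d : psum 0 d = 0.
Proof. by rewrite /psum /partial_sum big1// => j _; rewrite mul0r. Qed.

Lemma LambdaE d : Lambda p_pr d = cyl d 0.
Proof.
by apply/seteqP; split => x H j /H; [move=> xj; apply/val_inj|move=> ->].
Qed.

Lemma Lambda_psum d x : Lambda p_pr d x <-> psum x d = 0.
Proof. by rewrite LambdaE -(psum0 d) cylE. Qed.

Lemma Lambda_sub d x y : Lambda p_pr d (x - y) <-> psum x d = psum y d.
Proof.
rewrite Lambda_psum; split => [H|H].
  by rewrite -(subrK y x) psumD H add0r psum_mod.
have /eqP : psum (x - y + y) d = psum (0 + y) d by rewrite subrK add0r.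
rewrite (psumD (x - y)) (psumD 0) psum0 eqz_modDr => /eqP.
by rewrite psum_mod mod0z.
Qed.

Lemma coset_Lambda d c : [set c + l | l in Lambda p_pr d] = cyl d c.
Proof.
apply/seteqP; split => [_ [l Hl <-]|x].
  by apply/cylE/Lambda_sub; rewrite addrAC subrr add0r.
move=> /cylE/Lambda_sub H; exists (x - c) => //.
by rewrite addrC subrK.
Qed.

Lemma cyl_refl d c : cyl d c c.
Proof. by []. Qed.

Lemma cyl_trans d c x : cyl d c x -> cyl d x = cyl d c.
Proof.
by move=> H; apply/seteqP; split => y Hy j jd; rewrite Hy // H.
Qed.

Lemma sub_cyl d d' c : (d <= d')%N -> cyl d' c `<=` cyl d c.
Proof. by move=> dd x H j jd; apply: H; exact: leq_trans dd. Qed.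

Lemma open_cyl d c : open (cyl d c).
Proof.
rewrite -coset_Lambda.
exists [set [set c + l | l in Lambda p_pr d]]; last by rewrite bigcup_set1.
move=> _ ->; exists [fset (c, d)]%fset => //.
  by move=> i _; rewrite inE.
apply/seteqP; split => [x|x xc i /=]; last by rewrite inE => /eqP ->.
by move=> /(_ (c, d)); apply; rewrite /= inE.
Qed.

(** A basic open set is a finite intersection of cosets, so the longest prefix that occurs among
    them serves as [d]. *)
Lemma nbhs_cyl x (A : set Delta) : open A -> A x -> exists d, cyl d x `<=` A.
Proof.
move=> [D DF <-] [B DB Bx].
have [F _ FB] := DF _ DB.
exists (\max_(i <- enum_fset F) i.2)%N.
have {}FB : \bigcap_(i in [set` F]) [set i.1 + l | l in Lambda p_pr i.2] = B := FB.
move: Bx; rewrite -[X in X x]/B -FB => Bx.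
move=> y Hy; exists B => //; rewrite -[X in X y]/B -FB => i Fi.
have := Bx i Fi; rewrite !coset_Lambda => Hi.
rewrite /= -(cyl_trans Hi); apply: sub_cyl Hy.
by apply: (@leq_bigmax_seq _ _ predT (fun i => i.2)).
Qed.

Lemma measurable_cyl d c : measurable (cyl d c).
Proof. apply: sub_sigma_algebra; exact: open_cyl. Qed.

Definition cylinders : set (set Delta) :=
  [set A | A = set0 \/ exists d c, A = cyl d c].

Lemma open_cylinders (A : set Delta) : open A -> <<s cylinders >> A.
Proof.
move=> oA.
pose pre (x : Delta) d := mkseq (fun j => nat_of_ord (x j)) d.
(* [F s] is the cylinder with prefix [s] if it lies in [A], and empty otherwise; there are only
   countably many prefixes. *)
pose F (s : seq nat) := [set x | exists c d, [/\ pre c d = s, cyl d c x & cyl d c `<=` A]].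
have -> : A = \bigcup_s F s.
  apply/seteqP; split => [x Ax|x [s _] [c [d [_ ?]]]]; last exact.
  have [d dA] := nbhs_cyl oA Ax.
  by exists (pre x d) => //; exists x, d.
have cyl_pre d c c' : pre c d = pre c' d -> cyl d c = cyl d c'.
  move=> H; apply: cyl_trans => j jd; apply/val_inj.
  by have /(congr1 (nth 0%N ^~ j)) := H; rewrite !nth_mkseq.
apply: (@countable_bigcupT_measurable _ (g_sigma_algebraType cylinders)) => [|s].
  exact: countableP.
have [[c [d [cs dA]]]|nF] := pselect (exists c d, pre c d = s /\ cyl d c `<=` A).
  suff -> : F s = cyl d c by apply: sub_sigma_algebra; right; exists d, c.
  apply/seteqP; split => [x [c' [d' [c's]]]|x cx]; last by exists c, d.
  have dd : d = d' by have := size_mkseq (fun j => nat_of_ord (c j)) d;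
    rewrite -/(pre c d) cs -c's size_mkseq.
  by subst d'; rewrite (@cyl_pre d c' c) ?cs.
suff -> : F s = set0 by exact: measurable0.
by apply/seteqP; split => x // [c [d [cs _ dA]]]; apply: nF; exists c, d.
Qed.

Lemma padic_measurableE : @measurable _ Delta = <<s cylinders >>.
Proof.
apply/seteqP; split; apply: smallest_sub.
- exact: smallest_sigma_algebra.
- exact: open_cylinders.
- exact: sigma_algebra_measurable.
- move=> A [->|[d [c ->]]]; [exact: measurable0|exact: measurable_cyl].
Qed.

Lemma cylinders_setI : setI_closed cylinders.
Proof.
move=> A B [->|[d [c ->]]]; first by rewrite set0I; left.
move=> [->|[d' [c' ->]]]; first by rewrite setI0; left.
have [->|/set0P [x [xc xc']]] := eqVneq (cyl d c `&` cyl d' c') set0; first by left.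
right; exists (maxn d d'), x; rewrite -(cyl_trans xc) -(cyl_trans xc').
apply/seteqP; split => [y [y1 y2] j|y Hy].
  by rewrite leq_max => /orP[/y1|/y2].
by split; apply: sub_cyl Hy; rewrite ?leq_maxl ?leq_maxr.
Qed.

(** The cylinders are closed under intersection and include the whole group, as the cylinder of
    length 0, so the constant sequence [setT] exhausts the space. *)
Lemma padic_measure_unique (R : realType) (m1 m2 : {measure set Delta -> \bar R}) :
  (m1 setT < +oo)%E -> (forall d c, m1 (cyl d c) = m2 (cyl d c)) ->
  forall A, measurable A -> m1 A = m2 A.
Proof.
move=> fin H; apply: (measure_unique cylinders (fun=> setT)) => //.
- exact: padic_measurableE.
- exact: cylinders_setI.
- by move=> _; right; exists 0%N, 0; apply/seteqP.
- by rewrite bigcup_const.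
- by move=> A [->|[d [c ->]]]; rewrite ?measure0.
Qed.

Lemma measurable_to_padic (d' : measure_display) (T : measurableType d') (f : T -> Delta) :
  (forall d c, measurable (f @^-1` cyl d c)) -> measurable_fun setT f.
Proof.
move=> H; apply: (measurability cylinders); first exact: padic_measurableE.
move=> _ [A [->|[d [c ->]]] <-]; rewrite setTI ?preimage_set0//.
Qed.

Lemma psum_fibre d (m : int) :
  [set x : Delta | psum x d = m] = set0 \/
  exists c, [set x : Delta | psum x d = m] = cyl d c.
Proof.
have [->|/set0P [x xm]] := eqVneq [set x | psum x d = m] set0; first by left.
by right; exists x; apply/seteqP; split => y /= => [ym|/cylE ->//];
  apply/cylE; rewrite ym.
Qed.

Lemma measurable_psum_fibre d (m : int) : measurable [set x : Delta | psum x d = m].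
Proof.
by have [->|[c ->]] := psum_fibre d m; [exact: measurable0|exact: measurable_cyl].
Qed.

(** Modulo p^d a sum depends only on the truncations of its summands, so the preimage of a cylinder
    is a countable union of rectangles, indexed by the truncation [k] of the first summand. *)
Lemma measurable_padic_add :
  measurable_fun setT (fun z : Delta * Delta => z.1 + z.2).
Proof.
apply: measurable_to_padic => d c.
pose F (k : int) := ([set x : Delta | psum x d = k] `*`
  [set y : Delta | ((k + psum y d) %% p%:Z ^+ d)%Z = psum c d]).
have -> : (fun z : Delta * Delta => z.1 + z.2) @^-1` cyl d c = \bigcup_k F k.
  apply/seteqP; split => [[x y] /cylE /= H|[x y] [k _] [/= xk yk]].
    by exists (psum x d) => //; split => //=; rewrite -psumD.
  by apply/cylE; rewrite psumD /= xk.
apply: countable_bigcupT_measurable => [|k]; first exact: countableP.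
apply: measurableX; first exact: measurable_psum_fibre.
have -> : [set y : Delta | ((k + psum y d) %% p%:Z ^+ d)%Z = psum c d] =
    \bigcup_(l in [set l : int | ((k + l) %% p%:Z ^+ d)%Z = psum c d])
      [set y : Delta | psum y d = l].
  apply/seteqP; split => [y Hy|y [l Hl] yl]; first by exists (psum y d).
  by rewrite /= yl.
rewrite bigcup_mkcond; apply: countable_bigcupT_measurable => [|l].
  exact: countableP.
by case: ifP => _; [exact: measurable_psum_fibre|exact: measurable0].
Qed.

Lemma padic_addl_measurable (c : Delta) : measurable_fun setT (fun x => c + x).
Proof.
exact: (measurableT_comp measurable_padic_add
  (measurable_fun_pair (measurable_cst c) (@measurable_id _ _ setT))).
Qed.

Lemma padic_addl_image (c : Delta) (A : set Delta) :
  [set c + x | x in A] = (fun x => - c + x) @^-1` A.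
Proof.
apply/seteqP; split => [_ [x Ax <-]|x Ax] /=; first by rewrite addKr.
by exists (- c + x) => //; rewrite addNKr.
Qed.

End Padic.

Lemma measurable_fun_discrete2 (d : measure_display) (T : measurableType d)
    (I J : countType) (V : Type) (op : I -> J -> V) (f : T -> I) (g : T -> J)
    (B : set V) :
  (forall i, measurable (f @^-1` [set i])) ->
  (forall j, measurable (g @^-1` [set j])) ->
  measurable ((fun t => op (f t) (g t)) @^-1` B).
Proof.
move=> mf mg.
have -> : (fun t => op (f t) (g t)) @^-1` B =
    \bigcup_(ij in [set ij : I * J | B (op ij.1 ij.2)])
      (f @^-1` [set ij.1] `&` g @^-1` [set ij.2]).
  apply/seteqP; split => [t Bt|t [[i j] /= Bij [ft gt]]].
    by exists (f t, g t).
  by rewrite /= ft gt.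
rewrite bigcup_mkcond; apply: countable_bigcupT_measurable => [|[i j]].
  exact: countableP.
by case: ifP => _ //; exact: measurableI.
Qed.

Lemma measurable_partial_sum (d : measure_display) (T : measurableType d) p
    (Y : nat -> T -> int) n :
  (forall j, measurable_fun setT (Y j)) ->
  measurable_fun setT (fun t => partial_sum p (fun j => Y j t) n).
Proof.
move=> mY; elim: n => [|n IH] _ B _; rewrite setTI.
  rewrite (_ : (fun _ => _) = cst 0) ?preimage_cst; last first.
    by apply/funext => t; rewrite /partial_sum big_ord0.
  by case: ifP.
rewrite (_ : (fun _ => _) = fun t =>
    partial_sum p (fun j => Y j t) n + Y n t * p%:Z ^+ n); last first.
  by apply/funext => t; rewrite partial_sumS.
apply: (@measurable_fun_discrete2 _ _ _ _ _ (fun a b => a + b * p%:Z ^+ n)) => i.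
  by have := IH measurableT [set i] I; rewrite setTI.
by have := mY n measurableT [set i] I; rewrite setTI.
Qed.

Section Padic.
Context (p : nat) (p_pr : prime p).
Local Notation Delta := (padic p_pr).

Lemma measurable_phi (d : measure_display) (T : measurableType d)
    (Y : nat -> T -> int) :
  (forall j, measurable_fun setT (Y j)) ->
  measurable_fun setT (fun t => phi p_pr (fun j => Y j t)).
Proof.
move=> mY; apply: measurable_to_padic => n c.
rewrite (_ : _ @^-1` _ = (fun t => partial_sum p (fun j => Y j t) n) @^-1`
    [set m | (m %% p%:Z ^+ n)%Z = psum c n]).
  rewrite -[X in measurable X]setTI.
  exact: (measurable_partial_sum p n mY).
by apply/seteqP; split => t; rewrite /= cylE /psum partial_sum_phi.
Qed.

Lemma measurable_Lambda n : measurable (Lambda p_pr n).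
Proof. by rewrite LambdaE; exact: measurable_cyl. Qed.

Lemma LambdaN n (x : Delta) : Lambda p_pr n x -> Lambda p_pr n (- x).
Proof.
move=> Lx; rewrite -[- x]add0r; apply/Lambda_sub.
by rewrite psum0 (iffLR (Lambda_psum _ _) Lx).
Qed.

(** * Uniqueness of normalized Haar measure *)

Section HaarUnique.
Context (R : realType) (H : set Delta).
Hypothesis (mH : measurable H) (HN : forall x, H x -> H (- x)).

(** [mu] is carried by [H], and for [x] in [H] the set under [nu] is the translate of [A] by [- x],
    again an element of [H]; so the integrand is almost everywhere the constant [nu A]. *)
Let haar_translate (mu nu : probability Delta R) (A : set Delta) :
  mu H = 1%E -> @is_normalized_haar R _ Delta +%R H nu -> measurable A ->
  (\int[mu]_x nu [set y : Delta | A ((x : Delta) + y)%R] = nu A)%E.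
Proof.
move=> mu1 [nu1 nuH] mA.
transitivity (\int[mu]_x (cst (nu A) x))%E; last first.
  by rewrite integral_cst//= probability_setT mule1.
apply: ae_eq_integral => //.
  rewrite (_ : (fun _ => _) =
    nu \o xsection ((fun z : Delta * Delta => z.1 + z.2) @^-1` A)).
    apply: measurable_fun_xsection.
    by rewrite -[X in measurable X]setTI; exact: measurable_padic_add.
  by apply/funext => x /=; rewrite xsectionE.
exists (~` H); split; first exact: measurableC.
  transitivity (1 - mu H)%E; first exact: probability_setC.
  by rewrite mu1 subee.
move=> x /= Hx Hxx; apply: Hx => _ /=.
rewrite -(nuH _ (HN Hxx) A)//.
by rewrite padic_addl_image opprK.
Qed.

Lemma normalized_haar_unique (mu nu : probability Delta R) :
  @is_normalized_haar R _ Delta +%R H mu -> @is_normalized_haar R _ Delta +%R H nu ->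
  forall A, measurable A -> mu A = nu A.
Proof.
move=> hmu hnu A mA.
rewrite -(haar_translate (proj1 hnu) hmu mA) -(haar_translate (proj1 hmu) hnu mA).
pose B := (fun z : Delta * Delta => z.1 + z.2) @^-1` A.
have mB : measurable B.
  by rewrite -[X in measurable X]setTI; exact: measurable_padic_add.
(* Both iterated integrals are the mass of [B] under a product measure, and the two orders of
   integration agree on rectangles. *)
have : (mu \x nu)%E B = (mu \x^ nu)%E B.
  apply: product_measure_unique => // A1 A2 mA1 mA2.
  exact: product_measure2E.
rewrite /product_measure1 /product_measure2 => E.
rewrite [RHS](_ : _ = (\int[mu]_x (nu \o xsection B) x)%E); last first.
  by apply: eq_integral => x _ /=; rewrite xsectionE.
rewrite E; apply: eq_integral => y _ /=; rewrite ysectionE; congr (mu _).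
by apply/seteqP; split => x; rewrite /B /= addrC.
Qed.

End HaarUnique.
End Padic.

(** * Residues and characters *)

Lemma intr_Zp_eq N (m n : int) : (1 < N)%N ->
  (m%:~R = n%:~R :> 'Z_N) <-> (m = n %[mod N%:Z])%Z.
Proof.
move=> N1; have NE : N%:~R = 0 :> 'Z_N by rewrite -pmulrn pchar_Zp.
have N0 : N%:Z != 0 by rewrite eqz_nat -lt0n ltnW.
have modE (k : int) : k%:~R = (k %% N%:Z)%Z%:~R :> 'Z_N.
  by rewrite {1}(divz_eq k N%:Z) intrD intrM NE mulr0 add0r.
split=> [|mn]; last by rewrite modE mn -modE.
rewrite (modE m) (modE n) -[(m %% _)%Z]gez0_abs ?modz_ge0//.
rewrite -[(n %% _)%Z]gez0_abs ?modz_ge0// => /(congr1 val) /=.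
have lt (k : int) : (`|(k %% N%:Z)%Z| < N)%N.
  by rewrite -ltz_nat gez0_abs ?modz_ge0// ltz_pmod// ltz_nat ltnW.
by rewrite -!pmulrn !val_Zp_nat// !modn_small// => ->.
Qed.

Section Padic.
Context (p : nat) (p_pr : prime p).
Local Notation Delta := (padic p_pr).

Lemma expn_prime_gt1 d : (1 < p ^ d.+1)%N.
Proof. by rewrite -{1}(expn0 p) ltn_exp2l// prime_gt1. Qed.

(** The exponent is [d.+1] because ['Z_(p ^ 0)] would have two elements instead of one. *)
Definition residue d (x : Delta) : 'Z_(p ^ d.+1) := (psum x d.+1)%:~R.

Let pXE d : (p ^ d)%N%:Z = p%:Z ^+ d.
Proof. by rewrite -!natz natrX. Qed.

Lemma residue_phi d y : residue d (phi p_pr y) = (partial_sum p y d.+1)%:~R.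
Proof.
apply/(intr_Zp_eq _ _ (expn_prime_gt1 d)).
by rewrite /psum partial_sum_phi pXE modz_mod.
Qed.

Lemma residueD d x y : residue d (x + y) = residue d x + residue d y.
Proof.
rewrite /residue -intrD; apply/(intr_Zp_eq _ _ (expn_prime_gt1 d)).
by rewrite psumD pXE modz_mod.
Qed.

Lemma residue_psum d x y : residue d x = residue d y <-> psum x d.+1 = psum y d.+1.
Proof.
split=> [|E]; last by rewrite /residue E.
by move/(intr_Zp_eq _ _ (expn_prime_gt1 d)); rewrite pXE !psum_mod.
Qed.

Lemma residue0 d : residue d 0 = 0.
Proof. by rewrite /residue psum0. Qed.

Lemma residue_eq0 d x : residue d x = 0 <-> Lambda p_pr d.+1 x.
Proof. by rewrite -(residue0 d) residue_psum Lambda_psum psum0. Qed.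

Lemma residue_surj d (m : 'Z_(p ^ d.+1)) : exists x, residue d x = m.
Proof.
(* All of [m] is placed at index 0, and [phi] performs the carries. *)
exists (phi p_pr (fun j => if j == 0%N then Posz m else 0)).
rewrite residue_phi /partial_sum big_ord_recl/= expr0 mulr1 big1.
  by rewrite addr0 -pmulrn natr_Zp.
by move=> j _; rewrite mul0r.
Qed.

Lemma residue_fibre d c : residue d @^-1` [set residue d c] = cyl d.+1 c.
Proof. by apply/seteqP; split => x /=; rewrite cylE residue_psum. Qed.

Lemma measurable_residue_fibre d m : measurable (residue d @^-1` [set m]).
Proof.
have [c <-] := residue_surj m.
by rewrite residue_fibre; exact: measurable_cyl.
Qed.

Section Characters.
Context (R : realType).
Local Notation C := (R[i]).

Lemma character_trivial (chi : Delta -> C) : is_character chi ->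
  exists d, forall x, Lambda p_pr d x -> chi x = 1.
Proof.
move=> [cchi n1 chiD].
have chi0 : chi 0 = 1.
  have nz : chi 0 != 0 by rewrite -normr_gt0 n1.
  by apply: (mulfI nz); rewrite -chiD mulr1 addr0.
have /(_ 0) := cchi.
have half0 : 0 < 2^-1 :> C by rewrite invr_gt0 ltr0n.
rewrite /continuous_at => /(@cvgr_dist_lt _ (C^o : normedModType C)) /(_ _ half0).
rewrite nbhsE => -[B [oB B0] BA].
have [d dB] := nbhs_cyl oB B0.
have small x : Lambda p_pr d x -> `|chi x - 1| < 2^-1.
  by rewrite LambdaE => /dB /BA /=; rewrite chi0 distrC.
exists d => x Lx; apply/eqP; rewrite -subr_eq0 -normr_le0.
(* Squaring multiplies the distance to 1 by |chi y + 1| >= 3/2. *)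
have grow n : forall y, Lambda p_pr d y -> `|chi y - 1| * (3 / 2) ^+ n <= 2^-1.
  elim: n => [|n IH] y Ly; first by rewrite expr0 mulr1 ltW// small.
  have Lyy : Lambda p_pr d (y + y).
    by apply/Lambda_psum; rewrite psumD (iffLR (Lambda_psum _ _) Ly) addr0 mod0z.
  apply: le_trans (IH _ Lyy); rewrite exprS mulrA ler_wpM2r//.
  rewrite chiD (_ : chi y * chi y - 1 = (chi y - 1) * (chi y + 1)); last by ring.
  rewrite normrM ler_wpM2l//.
  rewrite (_ : chi y + 1 = 2 - (1 - chi y)); last by ring.
  apply: le_trans (lerB_dist _ _).
  rewrite normr_nat distrC lerBrDr -lerBrDl.
  apply: le_trans (ltW (small _ Ly)) _.
  by rewrite (_ : 2 - 3 / 2 = 2^-1)//; field.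
(* The norm of [R[i]] has values in [R[i]]; from here on the real modulus [r] replaces it. *)
move: {grow} (fun n => grow n x Lx); rewrite normc_def; set r := Num.sqrt _ => grow.
have {}grow n : r * (3 / 2) ^+ n <= 2^-1.
  by rewrite -lecR rmorphM rmorphXn /= fmorph_div fmorphV /= !rmorph_nat.
rewrite lecR leNgt; apply/negP => r0.
(* Linear growth suffices: for [n > r^-1] the product [r * (n / 2)] already exceeds 1/2. *)
have ge n : n%:R / 2 <= (3 / 2) ^+ n :> R.
  elim: n => [|n IH]; first by rewrite mul0r expr0.
  have h : 1 <= (3 / 2) ^+ n :> R by rewrite exprn_ege1//; lra.
  by rewrite exprS -natr1; lra.
have [n nr] : exists n, r^-1 < n%:R.
  by exists (Num.bound r^-1); rewrite archi_boundP// invr_ge0 ltW.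
have : r * (n%:R / 2) <= 2^-1.
  by apply: le_trans (grow n); rewrite ler_pM2l.
move: nr; rewrite -(ltr_pM2l r0) mulfV ?gt_eqF//; lra.
Qed.

End Characters.
End Padic.

Lemma vanish_on_unity_roots (C : numClosedFieldType) N (w : 'I_N -> C) :
  (forall z : C, z ^+ N = 1 -> \sum_(m < N) w m * z ^+ m = 0) ->
  forall m, w m = 0.
Proof.
case: N w => [w _ []//|N w H m].
have [rs rsE] := closed_field_poly_normal ('X^(N.+1) - 1 : {poly C}).
have lc : lead_coef ('X^(N.+1) - 1 : {poly C}) = 1 by exact/eqP/monicXnsubC.
rewrite lc scale1r in rsE.
have urs : uniq rs.
  rewrite -separable.separable_prod_XsubC -rsE cyclotomic.separable_Xn_sub_1//.
have szrs : size rs = N.+1.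
  by apply: succn_inj; rewrite -(size_prod_XsubC _ id) -rsE size_XnsubC.
pose q := \poly_(i < N.+1) w (inord i).
have q0 : q = 0.
  apply: (@roots_geq_poly_eq0 _ q rs) => //; last by rewrite szrs size_poly.
  apply/allP => z; rewrite -root_prod_XsubC -rsE /root !hornerE ?hornerXn subr_eq0.
  move=> /eqP /H Hz; rewrite horner_poly -[X in _ == X]Hz.
  by apply/eqP/eq_bigr => i _; rewrite inord_val.
by have := coef_poly N.+1 (fun i => w (inord i)) m; rewrite -/q q0 coef0 ltn_ord inord_val.
Qed.

(** * Integrals of functions with finite range *)

Section FiniteRange.
Context (d : measure_display) (T : measurableType d) (R : realType).
Context (mu : {measure set T -> \bar R}) (F : finType) (q : T -> F).
Hypothesis mq : forall m, measurable (q @^-1` [set m]).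

(** The alternative [h m = 0] is there for chi - 1 integrated against [eta]: the fibre of 0 may have
    infinite mass, but the integrand vanishes on it. *)
Lemma integral_finite_range (h : F -> R) :
  (forall m, h m = 0 \/ (mu (q @^-1` [set m]) < +oo)%E) ->
  (\int[mu]_x (h (q x))%:E = \sum_m (h m)%:E * mu (q @^-1` [set m]))%E.
Proof.
move=> fin.
pose f m x := ((h m)%:E * (\1_(q @^-1` [set m]) x)%:E)%E.
have intf m : mu.-integrable setT (f m).
  have [hm0|mfin] := fin m.
    rewrite (_ : f m = cst 0%E); first exact: integrable0.
    by apply/funext => x; rewrite /f hm0 mul0e.
  apply: integrableZl => //; apply/integrableP; split.
    exact/measurable_EFinP.
  under eq_integral do rewrite gee0_abs//.
  by rewrite integral_indic// setIT.
rewrite (eq_integral (fun x => \sum_m f m x)%E); last first.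
  move=> x _; rewrite (bigD1 (q x))//= big1 ?adde0 => [|m mq']; last first.
    by rewrite /f indicE memNset ?mule0// => /= /eqP; rewrite eq_sym (negbTE mq').
  by rewrite /f indicE mem_set ?mule1.
rewrite integral_sum//; apply: eq_bigr => m _; rewrite /f.
have [->|mfin] := fin m.
  by rewrite mul0e; under eq_integral do rewrite mul0e; exact: integral0.
rewrite integralZl//; first by rewrite integral_indic// setIT.
apply/integrableP; split; first exact/measurable_EFinP.
under eq_integral do rewrite gee0_abs//.
by rewrite integral_indic// setIT.
Qed.

(** Extended values are allowed so that convolution powers can be integrated before they are known
    to be finite. *)
Lemma ge0_integral_finite_range (h : F -> \bar R) : (forall m, 0 <= h m)%E ->
  (\int[mu]_x h (q x) = \sum_m h m * mu (q @^-1` [set m]))%E.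
Proof.
move=> h0.
rewrite (eq_integral (fun x =>
    \sum_m h m * (\1_(q @^-1` [set m]) x)%:E)%E); last first.
  move=> x _; rewrite (bigD1 (q x))//= big1 ?adde0 => [|m mq']; last first.
    by rewrite indicE memNset ?mule0// => /= /eqP; rewrite eq_sym (negbTE mq').
  by rewrite indicE mem_set ?mule1.
rewrite ge0_integral_sum//.
- apply: eq_bigr => m _; rewrite ge0_integralZl//.
    by rewrite integral_indic// setIT.
  exact/measurable_EFinP.
- by move=> m; apply: emeasurable_funM => //; exact/measurable_EFinP.
- by move=> m x _; rewrite mule_ge0// lee_fin.
Qed.

Lemma Rintegral_finite_range (h : F -> R) :
  (forall m, h m = 0 \/ (mu (q @^-1` [set m]) < +oo)%E) ->
  \int[mu]_x h (q x) = \sum_m h m * fine (mu (q @^-1` [set m])).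
Proof.
move=> fin; rewrite /Rintegral integral_finite_range//.
have fin' m : ((h m)%:E * mu (q @^-1` [set m]) =
    (h m * fine (mu (q @^-1` [set m])))%:E)%E.
  have [->|mfin] := fin m; first by rewrite mul0e mul0r.
  by rewrite EFinM fineK// ge0_fin_numE.
by under eq_bigr do rewrite fin'; rewrite sumEFin.
Qed.

Lemma cintegral_finite_range (g : F -> R[i]) :
  (forall m, g m = 0 \/ (mu (q @^-1` [set m]) < +oo)%E) ->
  cintegral mu (g \o q) =
  \sum_m g m * (fine (mu (q @^-1` [set m])))%:C%C.
Proof.
move=> fin; rewrite /cintegral.
rewrite (Rintegral_finite_range (h := fun m => complex.Re (g m))); last first.
  by move=> m; have [->|] := fin m; [left|right].
rewrite (Rintegral_finite_range (h := fun m => complex.Im (g m))); last first.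
  by move=> m; have [->|] := fin m; [left|right].
apply/eqP; rewrite eq_complex !raddf_sum /=; apply/andP; split; apply/eqP;
  by apply: eq_bigr => m _; case: (g m) => a b /=; rewrite mulr0 ?subr0 ?add0r.
Qed.

End FiniteRange.

Section Padic.
Context (p : nat) (p_pr : prime p) (R : realType).
Local Notation Delta := (padic p_pr).
Local Notation C := (R[i]).

(** These are the characters chi_{d,l}, with z = exp(2 pi i l / p^(d+1)); they are continuous
    because they are constant on cylinders of length d+1. *)
Lemma root_is_character d (z : C) : z ^+ (p ^ d.+1) = 1 ->
  is_character (fun x : Delta => z ^+ (residue d x : 'I_ _)).
Proof.
move=> z1; have N0 : (0 < p ^ d.+1)%N by rewrite expn_gt0 prime_gt0.
split.
- move=> x A /= Ax; rewrite nbhs_simpl /=.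
  apply: (filterS (P := cyl d.+1 x)); last first.
    by apply: open_nbhs_nbhs; split; [exact: open_cyl|exact: cyl_refl].
  move=> y /cylE/residue_psum /= ->; exact: nbhs_singleton Ax.
- move=> x; apply/eqP; rewrite normrX; apply/eqP.
  suff -> : `|z| = 1 by rewrite expr1n.
  by apply/eqP; rewrite -(pexpr_eq1 N0)// -normrX z1 normr1.
- move=> x y; rewrite residueD -exprD /= .
  by rewrite [X in (_ %% X)%N]Zp_cast ?expn_prime_gt1// expr_mod.
Qed.

Lemma fourier_unique (mu nu : probability Delta R) :
  (forall chi : Delta -> C, is_character chi -> cintegral mu chi = cintegral nu chi) ->
  forall A, measurable A -> mu A = nu A.
Proof.
move=> H; apply: padic_measure_unique.
  by apply: (@le_lt_trans _ _ 1%E); rewrite ?ltry// probability_le1.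
(* Residues see at least one digit, so the cylinder of length 0 is treated apart. *)
move=> [|d] c.
  rewrite (_ : cyl 0 c = setT); last exact/seteqP.
  by transitivity (1%E : \bar R); [|symmetry]; exact: probability_setT.
rewrite -residue_fibre.
have fin (P : probability Delta R) m : (P (residue d @^-1` [set m]) < +oo)%E.
  by rewrite -ge0_fin_numE// fin_num_measure//; exact: measurable_residue_fibre.
have NE := Zp_cast (expn_prime_gt1 p_pr d).
pose w m : C := (fine (mu (residue d @^-1` [set m])) -
  fine (nu (residue d @^-1` [set m])))%:C%C.
suff : w (residue d c) = 0.
  move=> /(congr1 (@complex.Re R)) /= /eqP; rewrite subr_eq0 => /eqP E.
  by rewrite -[LHS]fineK ?ge0_fin_numE// E fineK// ge0_fin_numE.
apply: vanish_on_unity_roots => z z1.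
have {}z1 : z ^+ (p ^ d.+1) = 1 by rewrite -NE.
have cE (P : probability Delta R) :
    cintegral P (fun x => z ^+ (residue d x : 'I_ _)) =
    \sum_(m < _) z ^+ m * (fine (P (residue d @^-1` [set m])))%:C%C.
  apply: (cintegral_finite_range (q := residue d)
    _ (g := fun m : 'I_ _ => z ^+ m)) => m; last by right; exact: fin.
  exact: measurable_residue_fibre.
have := H _ (root_is_character z1); rewrite !cE.
move=> /eqP; rewrite -subr_eq0 -sumrB => /eqP E; rewrite -[RHS]E.
by apply: eq_bigr => m _; rewrite -mulrBr -rmorphB mulrC.
Qed.

End Padic.

(** * The complex exponential series *)

Section Cexp.
Context (R : realType).
Local Notation C := (R[i]).

Lemma is_cvg_pseries_dominated (A M t : R) (f : nat -> R) :
  (forall k, `|f k| <= A * (M ^+ k / k`!%:R)) -> cvgn (pseries f t).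
Proof.
move=> fM; apply: normed_cvg.
pose v k := A * (M ^+ k / k`!%:R) * `|t| ^+ k.
have fv k : `|f k| * `|t| ^+ k <= v k by rewrite ler_wpM2r.
apply: (@series_le_cvg _ _ v) => [k|k|k|] //.
- by rewrite normr_ge0.
- by apply: le_trans (fv k); rewrite mulr_ge0.
- by rewrite /= normrM normrX.
- rewrite (_ : v = A *: exp_coeff (M * `|t|)).
    by apply: is_cvg_seriesZ; exact: is_cvg_series_exp_coeff.
  apply/funext => k; rewrite /v -[RHS]/(A * ((M * `|t|) ^+ k / k`!%:R)) exprMn.
  by ring.
Qed.

Section Series.
Variable z : C.
Let x := complex.Re z.
Let y := complex.Im z.
Let M := `|x| + `|y|.
Let re k := complex.Re (z ^+ k).
Let im k := complex.Im (z ^+ k).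

Let reS k : re k.+1 = x * re k - y * im k.
Proof. by rewrite /re /im exprS /x /y; case: z (z ^+ k) => a b [c d]. Qed.

Let imS k : im k.+1 = x * im k + y * re k.
Proof. by rewrite /re /im exprS /x /y; case: z (z ^+ k) => a b [c d]. Qed.

(** The 1-norm on R^2 is submultiplicative for complex multiplication; this bounds both coordinates
    by one real exponential series. *)
Let bound k : `|re k| + `|im k| <= M ^+ k.
Proof.
elim: k => [|k IH]; first by rewrite /re /im expr0 /= normr1 normr0 addr0.
rewrite reS imS exprS.
apply: le_trans (ler_wpM2l _ IH); last by rewrite addr_ge0.
have h1 := ler_normB (x * re k) (y * im k).
have h2 := ler_normD (x * im k) (y * re k).
rewrite (le_trans (lerD h1 h2))// !normrM /M; lra.
Qed.

Let c k := re k / k`!%:R.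
Let s k := im k / k`!%:R.

Let fact_gt0 k : 0 < k`!%:R :> R.
Proof. by rewrite ltr0n fact_gt0. Qed.

Let c_bound k : `|c k| <= M ^+ k / k`!%:R.
Proof.
rewrite normrM normfV (ger0_norm (ltW (fact_gt0 k))) ler_wpM2r ?invr_ge0 ?(ltW (fact_gt0 k))//.
by apply: le_trans (bound k); rewrite lerDl.
Qed.

Let s_bound k : `|s k| <= M ^+ k / k`!%:R.
Proof.
rewrite normrM normfV (ger0_norm (ltW (fact_gt0 k))) ler_wpM2r ?invr_ge0 ?(ltW (fact_gt0 k))//.
by apply: le_trans (bound k); rewrite lerDr.
Qed.

Let diffs_c : pseries_diffs c = (fun k => x * c k - y * s k).
Proof.
apply/funext => k; rewrite /pseries_diffs /c /s reS factS natrM.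
have := fact_gt0 k; move: (k`!%:R : R) => F F0.
by field; rewrite lt0r_neq0//= pnatr_eq0.
Qed.

Let diffs_s : pseries_diffs s = (fun k => x * s k + y * c k).
Proof.
apply/funext => k; rewrite /pseries_diffs /c /s imS factS natrM.
have := fact_gt0 k; move: (k`!%:R : R) => F F0.
by field; rewrite lt0r_neq0//= pnatr_eq0.
Qed.

Let lin (a b : R) (f g : nat -> R) t : cvgn (pseries f t) -> cvgn (pseries g t) ->
  pseries (fun k => a * f k + b * g k) t @ \oo --> 
  a * limn (pseries f t) + b * limn (pseries g t).
Proof.
move=> cf cg.
rewrite (_ : pseries _ t = (a *: pseries f t) + (b *: pseries g t)).
  by apply: cvgD; apply: cvgZl_tmp.
apply/funext => n; rewrite /pseries /series /= -[RHS]/(a * _ + b * _) !mulr_sumr -big_split /=.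
by apply: eq_bigr => k _; ring.
Qed.

(** Combinations of [c] and [s] are stable under formal differentiation ([diffs_cs]), so this covers
    the series and the first two derived series, all of which [pseries_snd_diffs] asks for. *)
Let cvg_cs (a b t : R) : cvgn (pseries (fun k => a * c k + b * s k) t).
Proof.
apply: (@is_cvg_pseries_dominated (`|a| + `|b|) M) => k.
rewrite (le_trans (ler_normD _ _))// normrM [leLHS]addrC normrM addrC mulrDl lerD// ler_wpM2l//.
Qed.

Let Cs t := limn (pseries c t).
Let Ss t := limn (pseries s t).

Let cE : c = fun k => 1 * c k + 0 * s k.
Proof. by apply/funext => k; rewrite mul1r mul0r addr0. Qed.

Let sE : s = fun k => 0 * c k + 1 * s k.
Proof. by apply/funext => k; rewrite mul1r mul0r add0r. Qed.

Let diffs_cs (a b : R) : pseries_diffs (fun k => a * c k + b * s k) =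
  (fun k => (a * x + b * y) * c k + (b * x - a * y) * s k).
Proof.
apply/funext => k.
have hc : k.+1%:R * c k.+1 = x * c k - y * s k := congr1 (@^~ k) diffs_c.
have hs : k.+1%:R * s k.+1 = x * s k + y * c k := congr1 (@^~ k) diffs_s.
transitivity (a * (k.+1%:R * c k.+1) + b * (k.+1%:R * s k.+1)).
  by rewrite /pseries_diffs mulrDr !(mulrCA k.+1%:R).
by rewrite hc hs; ring.
Qed.

Let cvg_c t : cvgn (pseries c t).
Proof. by rewrite cE. Qed.

Let cvg_s t : cvgn (pseries s t).
Proof. by rewrite sE. Qed.

Let derive_Cs t : is_derive t (1 : R) Cs (x * Cs t - y * Ss t).
Proof.
have -> : x * Cs t - y * Ss t = limn (pseries (pseries_diffs c) t).
  rewrite cE diffs_cs; symmetry; apply/cvg_lim => //.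
  rewrite (_ : x * _ - _ = (1 * x + 0 * y) * Cs t + (0 * x - 1 * y) * Ss t).
    exact: lin.
  by ring.
(* Any radius beyond [|t|] would do, since the series converge everywhere. *)
apply: (@pseries_snd_diffs _ _ (`|t| + 1)).
- by [].
- by rewrite cE diffs_cs.
- by rewrite cE !diffs_cs.
- by rewrite [ltRHS]ger0_norm ?addr_ge0// ltrDl.
Qed.

Let derive_Ss t : is_derive t (1 : R) Ss (x * Ss t + y * Cs t).
Proof.
have -> : x * Ss t + y * Cs t = limn (pseries (pseries_diffs s) t).
  rewrite sE diffs_cs; symmetry; apply/cvg_lim => //.
  rewrite (_ : x * _ + _ = (0 * x + 1 * y) * Cs t + (1 * x - 0 * y) * Ss t).
    exact: lin.
  by ring.
apply: (@pseries_snd_diffs _ _ (`|t| + 1)).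
- by [].
- by rewrite sE diffs_cs.
- by rewrite sE !diffs_cs.
- by rewrite [ltRHS]ger0_norm ?addr_ge0// ltrDl.
Qed.

Let pseries0 (f : nat -> R) : limn (pseries f 0) = f 0%N.
Proof.
apply/cvg_lim => //; rewrite -(cvg_shiftS _) /=.
rewrite (_ : (fun _ => _) = cst (f 0%N)); first exact: cvg_cst.
apply/funext => n; rewrite /pseries /series /= big_nat_recl// expr0 mulr1 big1 ?addr0//.
by move=> i _; rewrite expr0n mulr0.
Qed.

(* The derivatives vanish because t |-> (Cs t, Ss t) solves w' = z w. *)
Let rotA t : expR (- x * t) * (cos (y * t) * Cs t + sin (y * t) * Ss t) = 1.
Proof.
(* The left side is abstracted to a function [f] of [t], so that [f t] can be compared with
   [f 0]. *)
set v := LHS; pattern t in v; move: @v; set f := (X in let _ := X t in _) => /=.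
apply: (@eq_trans _ _ (f 0)); last first.
  rewrite /f !mulr0 expR0 cos0 sin0 /Cs pseries0 /c /re expr0 /=.
  by rewrite fact0 divr1 mul0r addr0 !mul1r.
apply: is_derive_0_is_cst => {}t.
have dC := derive_Cs t; have dS := derive_Ss t.
apply: trigger_derive; rewrite /GRing.scale /=.
by ring.
Qed.

(** With w = Cs + i Ss, [rotA] and [rotB] are the real and imaginary parts of exp(-zt) w(t) = 1. *)
Let rotB t : expR (- x * t) * (cos (y * t) * Ss t - sin (y * t) * Cs t) = 0.
Proof.
set v := LHS; pattern t in v; move: @v; set f := (X in let _ := X t in _) => /=.
apply: (@eq_trans _ _ (f 0)); last first.
  rewrite /f !mulr0 expR0 cos0 sin0 /Ss pseries0 /s /im expr0 /=.
  by rewrite fact0 divr1 !mul0r subr0 !mul1r.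
apply: is_derive_0_is_cst => {}t.
have dC := derive_Cs t; have dS := derive_Ss t.
apply: trigger_derive; rewrite /GRing.scale /=.
by ring.
Qed.

Let Cs1 : Cs 1 = expR x * cos y.
Proof.
have A := rotA 1; have B := rotB 1; rewrite !mulr1 in A B.
have e : expR x * expR (- x) = 1 by exact: expRxMexpNx_1.
(* Both inserted factors equal 1; after regrouping, [Cs 1] is expressed by the left sides of [A] and
   [B], which amounts to multiplying by exp(z). *)
transitivity (Cs 1 * (cos y ^+ 2 + sin y ^+ 2) * (expR x * expR (- x))).
  by rewrite cos2Dsin2 e !mulr1.
transitivity (expR x * (cos y * (expR (- x) * (cos y * Cs 1 + sin y * Ss 1)) -
  sin y * (expR (- x) * (cos y * Ss 1 - sin y * Cs 1)))); first by ring.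
by rewrite A B; ring.
Qed.

Let Ss1 : Ss 1 = expR x * sin y.
Proof.
have A := rotA 1; have B := rotB 1; rewrite !mulr1 in A B.
have e : expR x * expR (- x) = 1 by exact: expRxMexpNx_1.
transitivity (Ss 1 * (cos y ^+ 2 + sin y ^+ 2) * (expR x * expR (- x))).
  by rewrite cos2Dsin2 e !mulr1.
transitivity (expR x * (sin y * (expR (- x) * (cos y * Cs 1 + sin y * Ss 1)) +
  cos y * (expR (- x) * (cos y * Ss 1 - sin y * Cs 1)))); first by ring.
by rewrite A B; ring.
Qed.

Lemma cvg_Re_cexp :
  (fun n => \sum_(0 <= k < n) complex.Re (z ^+ k) / k`!%:R) @ \oo -->
  complex.Re (cexp z).
Proof.
rewrite (_ : complex.Re _ = Cs 1); last by rewrite Cs1 /x /y; case: z.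
rewrite (_ : (fun n => _) = pseries c 1); first exact: cvg_c.
by apply/funext => n; apply: eq_bigr => k _; rewrite /= expr1n mulr1.
Qed.

Lemma cvg_Im_cexp :
  (fun n => \sum_(0 <= k < n) complex.Im (z ^+ k) / k`!%:R) @ \oo -->
  complex.Im (cexp z).
Proof.
rewrite (_ : complex.Im _ = Ss 1); last by rewrite Ss1 /x /y; case: z.
rewrite (_ : (fun n => _) = pseries s 1); first exact: cvg_s.
by apply/funext => n; apply: eq_bigr => k _; rewrite /= expr1n mulr1.
Qed.

End Series.
End Cexp.

(** * Compound Poisson measures on Z^n *)

Section DiscreteEsum.
Context (n : nat) (R : realType).
Local Notation G := ('rV[int]_n).

Lemma discrete_measurableT (A : set G) : measurable A.
Proof. by []. Qed.

(** Pickling cuts [A] into countably many pieces of at most one point. This links measures on rows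
    to [levy_projection], which is given by point masses. *)
Lemma measure_esum (mu : {measure set G -> \bar R}) (A : set G) :
  (mu A = \esum_(l in A) mu [set l])%E.
Proof.
pose F (k : nat) : set G := A `&` [set l : G | choice.pickle l = k].
have AF : A = \bigcup_k F k.
  by apply/seteqP; split => [l Al|l [k _ []]//]; exists (choice.pickle l).
have tF : trivIset setT F.
  apply/trivIsetP => i j _ _ ij; apply/seteqP; split => // l [[_ /= li] [_ /= lj]].
  by move: ij; rewrite -li -lj eqxx.
have FE k : F k = set0 \/ exists l, F k = [set l].
  have [->|/set0P [l [Al /= lk]]] := eqVneq (F k) set0; first by left.
  right; exists l; apply/seteqP; split => [l' [Al' /= l'k]|_ ->] //=.
  by apply: (pcan_inj choice.pickleK); rewrite l'k lk.
rewrite {1}AF measure_bigcup//=.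
rewrite nneseries_esum//= set_mem_set {1}AF esum_bigcupT//.
apply: eq_esum => k _; have [->|[l ->]] := FE k.
  by rewrite measure0 esum_set0.
by rewrite esum_set1.
Qed.

End DiscreteEsum.

Section ConvolutionPower.
Context (n : nat) (R : realType).
Local Notation G := ('rV[int]_n).
Local Notation convp := (@convolution_power R _ G +%R 0).
Implicit Type nu : {measure set G -> \bar R}.

Lemma convolution_powerS nu k (A : set G) :
  convp nu k.+1 A = (\int[nu]_x convp nu k [set y : G | A ((x : G) + y)%R])%E.
Proof.
rewrite /convolution_power iterS {1}/convolution /pushforward /product_measure1.
by congr integral; apply/funext => x /=; rewrite xsectionE.
Qed.

Lemma convolution_power0 nu (A : set G) : convp nu 0 A = \d_(0 : G) A.
Proof. by []. Qed.

Lemma convolution_power_ge0 nu k A : (0 <= convp nu k A)%E.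
Proof.
elim: k A => [|k IH] A; first by rewrite convolution_power0.
by rewrite convolution_powerS; apply: integral_ge0.
Qed.

Section FiniteQuotient.
Variables (nu : {measure set G -> \bar R}) (nu_fin : (nu setT < +oo)%E).
Variables (F : finZmodType) (q : G -> F) (qD : {morph q : x y / x + y}).
Local Notation a k m := (convp nu k (q @^-1` [set m])).

Let nu_fine (A : set G) : nu A \is a fin_num.
Proof.
rewrite ge0_fin_numE//; apply: le_lt_trans nu_fin.
by apply: le_measure; rewrite ?inE//; exact: discrete_measurableT.
Qed.

(** Translating the fibre over [m] by [x] gives the fibre over [m - q x], so on fibres the
    convolution becomes a finite sum over [F]. *)
Lemma convolution_power_quotientS k m :
  a k.+1 m = (\sum_m' a k (m - m')%R * nu (q @^-1` [set m']))%E.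
Proof.
rewrite convolution_powerS.
rewrite -(@ge0_integral_finite_range _ _ _ nu _ q _ (fun m' => a k (m - m'))).
- apply: eq_integral => x _; congr (convp _ _ _).
  apply/seteqP; split => y /=; rewrite qD; first by move=> <-; rewrite addrAC subrr add0r.
  by move=> ->; rewrite addrC subrK.
- by move=> ?; exact: discrete_measurableT.
- by move=> ?; exact: convolution_power_ge0.
Qed.

Lemma convolution_power_fin_num k m : a k m \is a fin_num.
Proof.
elim: k m => [|k IH] m; first by rewrite convolution_power0 diracE.
rewrite convolution_power_quotientS; apply/sum_fin_numP => m' _ _.
by rewrite fin_numM.
Qed.

Section Fourier.
Variables (psi : F -> R[i]) (psi0 : psi 0 = 1).
Hypothesis (psiD : forall x y, psi (x + y) = psi x * psi y).
Local Notation z := (\sum_m psi m * (fine (nu (q @^-1` [set m])))%:C%C).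

Lemma convolution_power_fourier k :
  \sum_m psi m * (fine (a k m))%:C%C = z ^+ k.
Proof.
have q0 : q 0 = 0 by apply: (addrI (q 0)); rewrite -qD !addr0.
elim: k => [|k IH].
  have a0 m : a 0 m = (m == 0)%:R%:E.
    rewrite convolution_power0 diracE; congr ((nat_of_bool _)%:R%:E).
    by apply/idP/eqP => [|->]; rewrite inE /= q0.
  rewrite expr0; under eq_bigr do rewrite a0.
  rewrite (bigD1 0)//= eqxx psi0 mulr1 big1 ?addr0// => m m0.
  by rewrite (negbTE m0) mulr0.
rewrite exprS -IH mulr_suml.
under eq_bigr => m _.
  rewrite convolution_power_quotientS.
  rewrite (_ : fine _ = \sum_m' fine (a k (m - m')) * fine (nu (q @^-1` [set m']))).
    rewrite rmorph_sum mulr_sumr; over.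
  rewrite -sum_fine; last by move=> m' _; rewrite fin_numM// convolution_power_fin_num.
  by apply: eq_bigr => m' _; rewrite fineM// convolution_power_fin_num.
rewrite exchange_big /=; apply: eq_bigr => m' _.
(* The shift by [m'] separates the double sum into a product, by [psiD]. *)
rewrite (reindex_inj (addIr m')) mulr_sumr; apply: eq_bigr => m _.
by rewrite addrK psiD rmorphM /=; ring.
Qed.

Local Notation cp m := (@compound_poisson R _ G +%R 0 nu (q @^-1` [set m])).
Local Notation L m := (\sum_(0 <= k <oo) ((k`!%:R)^-1)%:E * a k m)%E.

Let L_ge0 m : (0 <= L m)%E.
Proof.
by apply: nneseries_ge0 => k _ _; rewrite mule_ge0 ?convolution_power_ge0// lee_fin.
Qed.

Let cvg_L m : L m \is a fin_num ->
  (fun N => \sum_(0 <= k < N) (k`!%:R)^-1 * fine (a k m)) @ \oo --> fine (L m).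
Proof.
move=> Lfin.
rewrite (_ : (fun _ => _) =
    fun N => fine (\sum_(0 <= k < N) ((k`!%:R)^-1)%:E * a k m)%E).
  apply: fine_cvg; rewrite fineK//.
  apply: is_cvg_nneseries => k _ _.
  by rewrite mule_ge0 ?convolution_power_ge0// lee_fin.
apply/funext => N /=; rewrite -sum_fine => [|k _].
  by apply: eq_bigr => k _; rewrite fineM ?convolution_power_fin_num.
by rewrite fin_numM// convolution_power_fin_num.
Qed.

(** [pr] stands for the real or the imaginary part: both limits are taken in [R] by one argument. *)
Let fourier_proj (pr : {additive R[i] -> R}) :
  (forall (w : R[i]) (r : R), pr (w * r%:C%C) = pr w * r) ->
  (forall m, L m \is a fin_num) ->
  (fun N => \sum_(0 <= k < N) pr (z ^+ k) / k`!%:R) @ \oo -->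
  \sum_m pr (psi m) * fine (L m).
Proof.
move=> prM Lfin.
rewrite (_ : (fun _ => _) = fun N => \sum_m pr (psi m) *
    \sum_(0 <= k < N) (k`!%:R)^-1 * fine (a k m)); last first.
  apply/funext => N; under [RHS]eq_bigr do rewrite mulr_sumr.
  rewrite exchange_big /=; apply: eq_bigr => k _.
  rewrite -convolution_power_fourier raddf_sum mulr_suml; apply: eq_bigr => m _.
  by rewrite prM; ring.
apply: cvg_big => [|m _]; first exact: add_continuous.
exact: cvgMl_tmp (cvg_L (Lfin m)).
Qed.

(** The series sums to exp(z), and the normalization contributes exp(-c), where the total mass [c]
    is the sum of the masses of the fibres; this is what turns [psi m] into [psi m - 1]. *)
Lemma compound_poisson_fourier : (forall m, cp m \is a fin_num) ->
  \sum_m psi m * (fine (cp m))%:C%C =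
  cexp (\sum_m (psi m - 1) * (fine (nu (q @^-1` [set m])))%:C%C).
Proof.
move=> cpfin; pose c := fine (nu setT).
(* [expR (- c)] is positive, so an infinite series would make [cp m] infinite. *)
have Lfin m : L m \is a fin_num.
  rewrite ge0_fin_numE// ltey; apply/eqP => Loo.
  by have := cpfin m; rewrite /compound_poisson Loo gt0_muley// lte_fin expR_gt0.
have cE : c = \sum_m fine (nu (q @^-1` [set m])).
  rewrite sum_fine//; congr fine.
  transitivity (\int[nu]_x (cst 1%E x))%E.
    by rewrite integral_cst ?mul1e//; exact: discrete_measurableT.
  rewrite (@ge0_integral_finite_range _ _ _ nu _ q _ (fun=> 1%E))//.
    by apply: eq_bigr => m _; rewrite mul1e.
have main : \sum_m psi m * (fine (L m))%:C%C = cexp z.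
  have reM (w : R[i]) (r : R) : complex.Re (w * r%:C%C) = complex.Re w * r.
    by case: w => u v /=; rewrite mulr0 subr0.
  have imM (w : R[i]) (r : R) : complex.Im (w * r%:C%C) = complex.Im w * r.
    by case: w => u v /=; rewrite mulr0 add0r.
  have reE := cvg_lim (@Rhausdorff R) (fourier_proj reM Lfin).
  have imE := cvg_lim (@Rhausdorff R) (fourier_proj imM Lfin).
  rewrite /= in reE imE.
  apply/eqP; rewrite eq_complex !raddf_sum /=; apply/andP; split; apply/eqP.
    under eq_bigr do rewrite reM.
    by rewrite -reE; apply/cvg_lim => //; exact: cvg_Re_cexp.
  under eq_bigr do rewrite imM.
  by rewrite -imE; apply/cvg_lim => //; exact: cvg_Im_cexp.
have -> : \sum_m (psi m - 1) * (fine (nu (q @^-1` [set m])))%:C%C = z - c%:C%C.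
  rewrite cE rmorph_sum -sumrB; apply: eq_bigr => m _.
  by rewrite mulrBl mul1r.
have -> : cexp (z - c%:C%C) = (expR (- c))%:C%C * cexp z.
  case: (z) => u v; apply/eqP; rewrite eq_complex /= !mul0r !subr0 addr0.
  by rewrite expRD (mulrC (expR u)) -!mulrA !eqxx.
rewrite -main mulr_sumr; apply: eq_bigr => m _.
by rewrite /compound_poisson fineM// rmorphM /= mulrCA.
Qed.

End Fourier.
End FiniteQuotient.
End ConvolutionPower.

(** * Projections of the Levy measure *)

Lemma measurable_to_row (d : measure_display) (T : measurableType d) n
    (f : T -> 'rV[int]_n) :
  (forall l, measurable (f @^-1` [set l])) -> measurable_fun setT f.
Proof.
move=> mf _ B _; rewrite setTI.
rewrite (_ : f @^-1` B = \bigcup_(l in B) f @^-1` [set l]); last first.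
  by apply/seteqP; split => [t Bt|t [l Bl /= ->]//]; exists (f t).
rewrite bigcup_mkcond; apply: countable_bigcupT_measurable => [|l].
  exact: countableP.
by case: ifP.
Qed.

Lemma measurable_row (d : measure_display) (T : measurableType d) n
    (Y : nat -> T -> int) : (forall j, measurable_fun setT (Y j)) ->
  measurable_fun setT (fun t => \row_(j < n) Y j t).
Proof.
move=> mY; apply: measurable_to_row => l.
rewrite (_ : _ @^-1` _ = \bigcap_(j in [set: 'I_n]) Y j @^-1` [set l 0 j]).
  apply: fin_bigcap_measurable => // j _.
  by rewrite -[X in measurable X]setTI; exact: mY.
apply/seteqP; split => [t /= <- j _ /=|t H]; first by rewrite mxE.
by apply/rowP => j; rewrite mxE; exact: H.
Qed.

Section Padic.
Context (p : nat) (p_pr : prime p) (R : realType).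
Local Notation Delta := (padic p_pr).
Implicit Type eta : {measure set Delta -> \bar R}.

Definition digits n (x : Delta) : 'rV[int]_n := \row_j Posz (x j).

Lemma digitsE n x c : digits n x = digits n c <-> cyl n c x.
Proof.
split=> [/rowP H j jn|H].
  have := H (Ordinal jn); rewrite !mxE /= => -[]; exact: val_inj.
by apply/rowP => -[j jn]; rewrite !mxE /= H.
Qed.

Lemma digits_eq0 n x : digits n x = 0 <-> Lambda p_pr n x.
Proof.
split=> [/rowP H j jn|H]; first by have := H (Ordinal jn); rewrite !mxE /= => -[].
by apply/rowP => -[j jn]; rewrite !mxE /= H.
Qed.

Lemma measurable_digits n : measurable_fun setT (digits n).
Proof.
apply: measurable_to_row => l.
have [->|/set0P [c /= cl]] := eqVneq (digits n @^-1` [set l]) set0.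
  exact: measurable0.
rewrite (_ : _ @^-1` _ = cyl n c); first exact: measurable_cyl.
by apply/seteqP; split => x; rewrite -digitsE /= cl.
Qed.

(** This is [levy_projection] in a form for which countable additivity is inherited from [eta]:
    removing Lambda_n removes exactly the mass that would fall on the zero row. *)
Definition levy_measure eta n (A : set 'rV[int]_n) : \bar R :=
  eta (digits n @^-1` A `&` ~` Lambda p_pr n).

Section LevyMeasure.
Variables (eta : {measure set Delta -> \bar R}) (n : nat).

Let mdig (A : set 'rV[int]_n) : measurable (digits n @^-1` A `&` ~` Lambda p_pr n).
Proof.
have mL : measurable (Lambda p_pr n) := @measurable_Lambda p p_pr n.
apply: measurableI; last exact: measurableC.
by rewrite -[X in measurable X]setTI; exact: measurable_digits.
Qed.

Let levy0 : @levy_measure eta n set0 = 0%E :> \bar R.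
Proof. by rewrite /levy_measure preimage_set0 set0I measure0. Qed.

Let levy_ge0 (A : set 'rV[int]_n) : (0 <= levy_measure eta A)%E.
Proof. exact: measure_ge0. Qed.

Let levy_additive : semi_sigma_additive (@levy_measure eta n).
Proof.
move=> F mF tF mUF; rewrite /levy_measure preimage_bigcup setI_bigcupl.
apply: measure_semi_sigma_additive => [i||]; first exact: mdig.
  apply/trivIsetP => i j _ _ ij; rewrite setIACA setIid -preimage_setI.
  by move/trivIsetP : tF => /(_ _ _ _ _ ij) ->//; rewrite preimage_set0 set0I.
by rewrite -setI_bigcupl -preimage_bigcup; exact: mdig.
Qed.

HB.instance Definition _ := isMeasure.Build _ _ _ (@levy_measure eta n)
  levy0 levy_ge0 levy_additive.

Lemma levy_projectionE : @levy_projection R p p_pr eta n = @levy_measure eta n.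
Proof.
apply/funext => A; rewrite [RHS](measure_esum (@levy_measure eta n)).
apply: eq_esum => l _; rewrite -[RHS]/(eta (digits n @^-1` [set l] `&` ~` Lambda p_pr n)).
case: eqP => [->|/eqP l0].
  rewrite (_ : _ `&` _ = set0) ?measure0//.
  by apply/seteqP; split => // x [/= /digits_eq0 ? []].
congr (eta _); apply/seteqP; split => [x H|x [/= <- _] j]; last by rewrite mxE.
have xl : digits n x = l by apply/rowP => j; rewrite mxE.
by split => //= /digits_eq0; rewrite xl; exact/eqP.
Qed.

Lemma levy_measure_fin : is_levy_measure eta -> (@levy_measure eta n setT < +oo)%E.
Proof. by move=> [_ H]; rewrite /levy_measure preimage_setT setTI. Qed.

End LevyMeasure.

(** Through this map the residue of [phi] depends on the first [d.+1] entries only, and additively;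
    it is the homomorphism [q] of the Fourier computation. *)
Definition row_residue d (l : 'rV[int]_d.+1) : 'Z_(p ^ d.+1) :=
  (\sum_(j < d.+1) l 0 j * p%:Z ^+ j)%:~R.

Lemma row_residueD d : {morph @row_residue d : x y / x + y}.
Proof.
move=> x y; rewrite /row_residue -intrD -big_split /=; congr (_%:~R).
by apply: eq_bigr => j _; rewrite mxE mulrDl.
Qed.

Lemma row_residue_phi d (y : nat -> int) :
  row_residue (\row_(j < d.+1) y j) = residue d (phi p_pr y).
Proof.
rewrite residue_phi; congr (_%:~R).
by apply: eq_bigr => j _; rewrite mxE.
Qed.

Lemma row_residue_digits d x : row_residue (digits d.+1 x) = residue d x.
Proof. by rewrite (row_residue_phi d (fun j => Posz (x j))) phi_digits. Qed.

(** [chi] factors through some [residue d], which turns both integrals into finite sums. The fibre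
    of 0 is where [eta] and its projection differ, and there [psi m - 1] is 0. *)
Lemma row_law_generalized_poisson eta (mu : probability Delta R) :
  is_levy_measure eta ->
  (forall d m, mu (residue d @^-1` [set m]) =
    @compound_poisson R _ 'rV[int]_d.+1 +%R 0 (@levy_projection R p p_pr eta d.+1)
      (@row_residue d @^-1` [set m])) ->
  is_generalized_poisson eta mu.
Proof.
move=> eta_levy muE chi chiP.
have [d chi1] := character_trivial chiP; have [_ n1 chiD] := chiP.
have chi0 : chi 0 = 1.
  have nz : chi 0 != 0 by rewrite -normr_gt0 n1.
  by apply: (mulfI nz); rewrite -chiD mulr1 addr0.
have sP (m : 'Z_(p ^ d.+1)) : exists x : Delta, residue d x = m by exact: residue_surj.
pose s m := xget 0 [set x : Delta | residue d x = m].
have sE m : residue d (s m) = m.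
  by have [x xm] := sP m; exact: (xgetI (P := [set x | residue d x = m]) _ xm).
(* [residue d] sees [d.+1] digits, one more than the triviality of [chi] on Lambda_d calls for. *)
have chi_eq x y : residue d x = residue d y -> chi x = chi y.
  move=> xy; rewrite -(subrK y x) chiD chi1 ?mul1r//.
  apply/Lambda_sub/psum_inj => j jd.
  by move/residue_psum/psum_inj : xy; apply; rewrite ltnW.
pose psi m := chi (s m).
have chiE : chi = psi \o residue d.
  by apply/funext => x; apply: chi_eq; rewrite sE.
have psi0 : psi 0 = 1 by rewrite -chi0; apply: chi_eq; rewrite sE residue0.
have psiD x y : psi (x + y) = psi x * psi y.
  by rewrite -chiD; apply: chi_eq; rewrite residueD !sE.
have mres m : measurable (residue d @^-1` [set m] : set Delta).
  exact: measurable_residue_fibre.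
pose nu : {measure set 'rV[int]_d.+1 -> \bar R} := @levy_measure eta d.+1.
have nufin : (nu setT < +oo)%E by exact: levy_measure_fin.
have nuE m : nu (@row_residue d @^-1` [set m]) =
    if m == 0 then 0%E else eta (residue d @^-1` [set m]).
  rewrite /nu /= /levy_measure; case: eqP => [->|/eqP m0].
    rewrite (_ : _ `&` _ = set0) ?measure0//; apply/seteqP; split => // x [].
    by rewrite /= row_residue_digits => /residue_eq0.
  congr (eta _); apply/seteqP; split => [x []|x /=].
    by rewrite /= row_residue_digits.
  move=> xm; split; first by rewrite /= row_residue_digits.
  by move=> /residue_eq0; rewrite xm; exact/eqP.
have mufin m : mu (residue d @^-1` [set m]) \is a fin_num by rewrite fin_num_measure.
have -> : cintegral mu chi = \sum_(m : 'Z_(p ^ d.+1))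
    psi m * (fine (mu (residue d @^-1` [set m])))%:C%C.
  rewrite {1}chiE; apply: cintegral_finite_range => //.
  by move=> m; right; have := mufin m; rewrite ge0_fin_numE.
have cpE m : mu (residue d @^-1` [set m]) =
    @compound_poisson R _ 'rV[int]_d.+1 +%R 0 nu (@row_residue d @^-1` [set m]).
  by rewrite muE levy_projectionE.
under eq_bigr do rewrite cpE.
rewrite (compound_poisson_fourier nufin (@row_residueD d) psi0 psiD); last first.
  by move=> m; rewrite -cpE.
congr cexp.
rewrite (_ : (fun x => chi x - 1) = (fun m => psi m - 1) \o residue d); last first.
  by rewrite chiE.
rewrite (_ : cintegral _ _ = \sum_(m : 'Z_(p ^ d.+1))
    (psi m - 1) * (fine (eta (residue d @^-1` [set m])))%:C%C); last first.
  apply: (cintegral_finite_range _ (g := fun m => psi m - 1)) => // m.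
  have [->|m0] := eqVneq m 0; [left|right]; first by rewrite psi0 subrr.
  have := nuE m; rewrite (negbTE m0) => <-; rewrite -ge0_fin_numE//.
  rewrite ge0_fin_numE//; apply: le_lt_trans nufin.
  by apply: le_measure; rewrite ?inE//; exact: discrete_measurableT.
apply: eq_bigr => m _; rewrite nuE; case: eqP => [->|//].
by rewrite psi0 subrr !mul0r.
Qed.

End Padic.

(** * Realizing consistent families of discrete laws *)

Section UnitInterval.
Context (R : realType).

Definition unit_lebesgue : set (measurableTypeR R) -> \bar R :=
  mrestr (@lebesgue_measure R) (measurable_itv `[0, 1[).

HB.instance Definition _ := Measure.on unit_lebesgue.

Let unit_lebesgueT : unit_lebesgue setT = 1%E.
Proof.
rewrite /unit_lebesgue /mrestr setTI.
by rewrite lebesgue_measure_itv/= lte_fin ltr01 oppr0 adde0.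
Qed.

HB.instance Definition _ :=
  Measure_isProbability.Build _ _ _ unit_lebesgue unit_lebesgueT.

End UnitInterval.

Section Tree.
Context (R : realType) (w : seq nat -> R).
Hypotheses (w_ge0 : forall s, 0 <= w s) (w_nil : w [::] = 1).
Hypothesis w_children : forall s, series (fun k => w (rcons s k)) @ \oo --> w s.

Let S s k := series (fun k => w (rcons s k)) k.

(* The prefix s owns the interval [left_end s, left_end s + w s[, which is cut
   from left to right into the intervals of its children. *)
Let left_end s : R := \sum_(i < size s) S (take i s) (nth 0%N s i).

Let left_end_rcons s k : left_end (rcons s k) = left_end s + S s k.
Proof.
rewrite /left_end size_rcons big_ord_recr /= nth_rcons ltnn eqxx.
rewrite -cats1 take_size_cat//; congr (_ + _); apply: eq_bigr => i _.
by rewrite nth_cat ltn_ord take_cat ltn_ord.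
Qed.

Let SS s k : S s k.+1 = S s k + w (rcons s k).
Proof. by rewrite /S seriesSr. Qed.

Let S_mono s : nondecreasing_seq (S s).
Proof. by apply/nondecreasing_seqP => k; rewrite SS lerDl. Qed.

Let S_le s k : S s k <= w s.
Proof.
rewrite -(cvg_lim (@Rhausdorff R) (@w_children s)).
by apply: (nondecreasing_cvgn_le (@S_mono s)); exact: cvgP (@w_children s).
Qed.

Let inside s (t : R) := left_end s <= t < left_end s + w s.

Let inside_rcons s k t :
  inside (rcons s k) t = (left_end s + S s k <= t < left_end s + S s k.+1).
Proof. by rewrite /inside left_end_rcons -addrA -SS. Qed.

Let inside_parent s k t : inside (rcons s k) t -> inside s t.
Proof.
rewrite inside_rcons /inside => /andP[h1 h2]; apply/andP; split.
  by apply: le_trans h1; rewrite lerDl /S /series sumr_ge0.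
by apply: lt_le_trans h2 _; rewrite lerD2l S_le.
Qed.

Let inside_unit s t : inside s t -> 0 <= t < 1.
Proof.
elim/last_ind: s => [|s k IH]; last by move/inside_parent.
by rewrite /inside /left_end big_ord0 add0r w_nil.
Qed.

Let inside_child s t : inside s t -> exists k, inside (rcons s k) t.
Proof.
move=> /andP[h1 h2].
have [K hK] : exists K, t < left_end s + S s K.
  have : \forall K \near \oo, t - left_end s < S s K.
    by apply: (cvgr_gt _ (@w_children s)); rewrite ltrBlDl.
  by case=> K _ /(_ K (leqnn _)); rewrite ltrBlDl => ?; exists K.
(* The partial sums are the right ends of the children's intervals; the first one beyond [t] belongs
   to the child that contains [t]. *)
have ex : exists K, t < left_end s + S s K by exists K.
case: (ex_minnP ex) => -[|k] kt kmin.
  by move: kt; rewrite /S /series /= big_geq// addr0 ltNge h1.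
exists k; rewrite inside_rcons kt andbT leNgt; apply/negP => /kmin.
by rewrite ltnn.
Qed.

Let inside_inj s k k' t : inside (rcons s k) t -> inside (rcons s k') t -> k = k'.
Proof.
wlog kk' : k k' / (k <= k')%N => [H i1 i2|].
  by have [/H|/ltnW /H] := leqP k k'; [exact|move=> ->].
rewrite !inside_rcons => /andP[_ h1] /andP[h2 _].
apply/eqP; rewrite eqn_leq kk' leqNgt; apply/negP => lt.
have := lt_le_trans h1 (lerD (lexx (left_end s)) (S_mono s lt)).
by move=> /lt_le_trans /(_ h2); rewrite ltxx.
Qed.

Let next s t : nat := xget 0%N [set k | inside (rcons s k) t].

Let address n t : seq nat := iter n (fun s => rcons s (next s t)) [::].

Let size_address n t : size (address n t) = n.
Proof. by elim: n => //= n IH; rewrite size_rcons IH. Qed.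

Let inside_address n t : 0 <= t < 1 -> inside (address n t) t.
Proof.
move=> t01; elim: n => [|n IH] /=.
  by rewrite /inside /left_end big_ord0 add0r w_nil.
have [k hk] := inside_child IH.
exact: (xgetI (P := [set k | inside (rcons _ k) t]) _ hk).
Qed.

Let inside_eq_address s t : inside s t -> address (size s) t = s.
Proof.
elim/last_ind: s => [//|s k IH] ins; rewrite size_rcons /=.
rewrite (IH (inside_parent ins)); congr rcons; apply: (inside_inj _ ins).
exact: (xgetI (P := [set k | inside (rcons s k) t]) _ ins).
Qed.

(** The sample space is the whole line; the points outside [[0, 1[], which have no mass, receive the
    default 0. *)
Let X n (t : measurableTypeR R) : nat := if 0 <= t < 1 then next (address n t) t else 0%N.

Let addressE n t : 0 <= t < 1 -> address n t = mkseq (fun i => X i t) n.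
Proof.
move=> t01; elim: n => [//|n IH].
by rewrite /= mkseqS -IH /X t01.
Qed.

Let insideE s : [set t | inside s t] = `[left_end s, left_end s + w s[%classic.
Proof. by apply/seteqP; split => t; rewrite /inside /= in_itv. Qed.

Let measurable_X n : measurable_fun setT (X n).
Proof.
move=> _ B _; rewrite setTI.
pose U : set (measurableTypeR R) := `[0, 1[%classic.
have mU : measurable U by exact: measurable_itv.
(* Inside the unit interval, [X n] is the last entry of the prefix of length [n.+1] whose interval
   contains the point. *)
rewrite (_ : X n @^-1` B = (if `[<B 0%N>] then ~` U else set0) `|`
  \bigcup_(s in [set s | size s = n.+1 /\ B (last 0%N s)]) [set t | inside s t]).
  apply: measurableU; first by case: ifP => _ //; exact: measurableC.
  rewrite bigcup_mkcond; apply: countable_bigcupT_measurable => [|s].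
    exact: countableP.
  by case: ifP => _ //; rewrite insideE; exact: measurable_itv.
apply/seteqP; split => t.
  move=> Bt; have [t01|t01] := boolP (0 <= t < 1).
    right; exists (address n.+1 t); last exact: inside_address.
    by split; [exact: size_address|move: Bt; rewrite /= /X t01 last_rcons].
  left; move: Bt; rewrite /= /X (negbTE t01) => /asboolP ->.
  by rewrite /U /= in_itv; exact/negP.
case.
  case: asboolP => // B0; rewrite /U /= in_itv => /negP t01.
  by rewrite /= /X (negbTE t01).
move=> [s [sn Bs] /= ins]; have := inside_eq_address ins; rewrite sn /= => sE.
by move: Bs; rewrite -sE last_rcons /X (inside_unit ins).
Qed.

(** A half-open interval of weight 0 is empty, so inside [[0, 1[] only prefixes of positive weight
    occur. The second clause therefore holds at every point, with [X n t != 0] excluding the default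
    value outside. *)
Lemma random_sequence : exists (d : measure_display) (T : measurableType d)
  (P : probability T R) (X : nat -> T -> nat),
  [/\ forall n, measurable_fun setT (X n),
    forall n t, X n t != 0%N -> 0 < w (mkseq (fun i => X i t) n.+1) &
    forall s, P [set t | mkseq (fun i => X i t) (size s) = s] = (w s)%:E].
Proof.
exists _, (measurableTypeR R), (@unit_lebesgue R), X; split.
- exact: measurable_X.
- move=> n t; have [t01 _|t01] := boolP (0 <= t < 1); last first.
    by rewrite {1}/X (negbTE t01).
  rewrite -addressE//; have /andP[h1 h2] := inside_address n.+1 t01.
  by rewrite -(ltrDl (left_end (address n.+1 t))) (le_lt_trans h1).
move=> s; rewrite -[LHS]/(lebesgue_measure (_ `&` _)).
rewrite (_ : _ `&` _ = [set t | inside s t]).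
  rewrite insideE lebesgue_measure_itv/= lte_fin ltrDl lt0r w_ge0 andbT.
  case: eqP => [->//|_] /=.
  by rewrite EFinD addeAC subee ?add0e.
apply/seteqP; split => t /=.
  by rewrite in_itv /= => -[+ t01]; rewrite -addressE// => <-; exact: inside_address.
move=> ins; have t01 := inside_unit ins; rewrite in_itv /=; split => //.
by rewrite -addressE//; exact: inside_eq_address.
Qed.

End Tree.

(** * Consistency of the compound Poisson laws *)

Lemma nneseries_cauchy_product (R : realType) (f g : nat -> R) (F : R) :
  (forall i, 0 <= f i) -> (forall i, 0 <= g i) ->
  (\sum_(i <oo) (f i)%:E = F%:E)%E ->
  (\sum_(k <oo) (\sum_(0 <= j < k.+1) f (k - j)%N * g j)%:E =
   F%:E * \sum_(j <oo) (g j)%:E)%E.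
Proof.
move=> f0 g0 fF.
(* Extension by 0 from the triangle j <= k to the quadrant, where the order of summation can be
   exchanged. *)
pose h (k j : nat) := (if (j < k.+1)%N then f (k - j)%N * g j else 0).
have h0 k j : (0 <= (h k j)%:E)%E.
  by rewrite lee_fin /h; case: ifP => // _; rewrite mulr_ge0.
transitivity (\sum_(k <oo) \sum_(j <oo) (h k j)%:E)%E.
  apply: eq_eseriesr => k _.
  rewrite (nneseries_split 0 k.+1)//= add0n eseries0 ?adde0.
    rewrite sumEFin; congr EFin; rewrite !big_mkord; apply: eq_bigr => j _.
    by rewrite /h ltn_ord.
  by move=> j kj _; rewrite /h ltnNge kj.
rewrite nneseries_interchange//.
transitivity (\sum_(j <oo) F%:E * (g j)%:E)%E; last first.
  by rewrite nneseriesZl// => j _; rewrite lee_fin.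
apply: eq_eseriesr => j _.
rewrite (nneseries_split 0 j)//= add0n big1_seq ?add0e; last first.
  move=> k /=; rewrite mem_index_iota /h ltnS => /andP[_].
  by rewrite ltnNge => /negbTE ->.
rewrite -(@nneseries_addn _ (fun k => (h k j)%:E))//.
rewrite (eq_eseriesr (g := fun i => (g j)%:E * (f i)%:E)%E); last first.
  by move=> i _; rewrite /h ltnS leq_addl addnK mulrC.
by rewrite nneseriesZl ?fF 1?muleC// => i _; rewrite lee_fin.
Qed.

Section ConvolutionMeasure.
Context (n : nat) (R : realType).
Local Notation G := ('rV[int]_n).
Local Notation convp := (@convolution_power R _ G +%R 0).
Variable nu : {measure set G -> \bar R}.

Section Additive.
Variable k : nat.

Let convp0 : convp nu k set0 = 0%E.
Proof.
elim: k => [|i IH]; first by rewrite convolution_power0 measure0.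
rewrite convolution_powerS integral0_eq//.
Qed.

(** By induction: translation keeps the sets disjoint, and the integral commutes with series of
    nonnegative terms. *)
Let convp_additive : semi_sigma_additive (convp nu k).
Proof.
elim: k => [|i IH] F mF tF mUF.
  exact: (@measure_semi_sigma_additive _ _ _ (\d_(0 : G)) F mF tF mUF).
rewrite [X in _ --> X](_ : _ = \sum_(j <oo) convp nu i.+1 (F j))%E.
  apply/cvg_closeP; split; last by rewrite closeE.
  by apply: is_cvg_nneseries => j _ _; exact: convolution_power_ge0.
rewrite convolution_powerS.
under [RHS]eq_eseriesr do rewrite convolution_powerS.
rewrite -(@integral_nneseries _ _ _ nu)//; last first.
  by move=> j x _; exact: convolution_power_ge0.
apply: eq_integral => x _; apply/esym/cvg_lim => //=.
rewrite (_ : [set y | _] = \bigcup_j [set y : G | F j ((x : G) + y)]).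
  apply: IH => //.
   apply/trivIsetP => a b _ _ ab; apply/seteqP; split => // y [Fa Fb].
  move/trivIsetP : tF => /(_ _ _ I I ab) /seteqP [] /(_ (x + y)) H _.
  exact: H.
by apply/seteqP; split => y [j _ Fj]; exists j.
Qed.

HB.instance Definition _ := isMeasure.Build _ _ _ (convp nu k)
  convp0 (convolution_power_ge0 nu k) convp_additive.

End Additive.

Local Notation cp := (@compound_poisson R _ G +%R 0 nu).

Let cp_term_ge0 k A : (0 <= ((k`!%:R)^-1)%:E * convp nu k A)%E.
Proof. by rewrite mule_ge0 ?convolution_power_ge0// lee_fin. Qed.

Let cp0 : cp set0 = 0%E.
Proof.
rewrite /compound_poisson eseries0 ?mule0// => k _ _.
by rewrite measure0 mule0.
Qed.

Lemma compound_poisson_ge0 A : (0 <= cp A)%E.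
Proof. by rewrite mule_ge0 ?lee_fin ?expR_ge0// nneseries_ge0. Qed.

Let cp_additive : semi_sigma_additive cp.
Proof.
move=> F mF tF mUF.
rewrite [X in _ --> X](_ : _ = \sum_(j <oo) cp (F j))%E.
  apply/cvg_closeP; split; last by rewrite closeE.
  by apply: is_cvg_nneseries => j _ _; exact: compound_poisson_ge0.
rewrite [RHS]nneseriesZl; last by move=> j _; exact: nneseries_ge0.
rewrite nneseries_interchange//; congr (_ * _)%E.
apply: eq_eseriesr => k _; rewrite nneseriesZl; last first.
  by move=> j _; exact: convolution_power_ge0.
by congr (_ * _)%E; apply/esym/cvg_lim => //; exact: measure_semi_sigma_additive.
Qed.

HB.instance Definition _ := isMeasure.Build _ _ _ cp
  cp0 compound_poisson_ge0 cp_additive.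

Lemma convolution_power_le k A : (nu setT < +oo)%E ->
  (convp nu k A <= ((fine (nu setT)) ^+ k)%:E)%E.
Proof.
move=> fin; have nuT : ((fine (nu setT))%:E = nu setT)%E.
  by rewrite fineK// ge0_fin_numE.
elim: k A => [|k IH] A.
  by rewrite convolution_power0 expr0 diracE lee_fin; case: (_ \in _).
rewrite convolution_powerS exprSr EFinM nuT.
rewrite -(@integral_cst _ _ _ nu setT)//.
by apply: ge0_le_integral => //.
Qed.

End ConvolutionMeasure.

Section Projection.
Context (p : nat) (p_pr : prime p) (R : realType) (n : nat).
Variable eta : {measure set (padic p_pr) -> \bar R}.
Hypothesis eta_levy : is_levy_measure eta.
Local Notation G := ('rV[int]_n).
Local Notation G' := ('rV[int]_n.+1).
Local Notation convp := (@convolution_power R _ G +%R 0).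
Local Notation convp' := (@convolution_power R _ G' +%R 0).

Definition row_init (l : G') : G := \row_j l 0 (widen_ord (leqnSn n) j).

Let nu : {measure set G -> \bar R} := @levy_measure p p_pr R eta n.
Let nu' : {measure set G' -> \bar R} := @levy_measure p p_pr R eta n.+1.

Lemma row_initD : {morph row_init : x y / x + y}.
Proof. by move=> x y; apply/rowP => j; rewrite !mxE. Qed.

Let shell := Lambda p_pr n `&` ~` Lambda p_pr n.+1.

Let mshell : measurable shell.
Proof.
have mL k : measurable (Lambda p_pr k) := @measurable_Lambda p p_pr k.
by apply: measurableI => //; exact: measurableC.
Qed.

Let shell_fin : (eta shell < +oo)%E.
Proof.
have mL k : measurable (Lambda p_pr k) := @measurable_Lambda p p_pr k.
apply: le_lt_trans (proj2 eta_levy n.+1).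
by apply: le_measure; rewrite ?inE//; [exact: measurableC|move=> x []].
Qed.

Let c := fine (eta shell).

Let c_ge0 : 0 <= c.
Proof. exact: fine_ge0. Qed.

Let cE : (c%:E = eta shell)%E.
Proof. by rewrite /c fineK// ge0_fin_numE. Qed.

Let nu_fin : (nu setT < +oo)%E.
Proof. exact: levy_measure_fin. Qed.

Let LambdaS x : Lambda p_pr n.+1 x -> Lambda p_pr n x.
Proof. by move=> H j jn; apply: H; exact: ltnW. Qed.

(* The part of eta on Lambda_n outside Lambda_(n+1) projects to mass at 0. *)
Lemma levy_measure_row_init (A : set G) :
  (nu' (row_init @^-1` A) = nu A + c%:E * \d_(0%R : G) A)%E.
Proof.
have mL k : measurable (Lambda p_pr k) := @measurable_Lambda p p_pr k.
have mdA : measurable (digits n @^-1` A : set (padic p_pr)).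
  by rewrite -[X in measurable X]setTI; exact: measurable_digits.
have initE x : row_init (digits n.+1 x) = digits n x :> G.
  by apply/rowP => j; rewrite !mxE.
rewrite cE -[LHS]/(eta (digits n.+1 @^-1` (row_init @^-1` A) `&` ~` Lambda p_pr n.+1)).
rewrite -[X in (X + _)%E]/(eta (digits n @^-1` A `&` ~` Lambda p_pr n)).
have -> : digits n.+1 @^-1` (row_init @^-1` A) `&` ~` Lambda p_pr n.+1 =
    (digits n @^-1` A `&` ~` Lambda p_pr n) `|` (digits n @^-1` A `&` shell).
  apply/seteqP; split => x /=; rewrite initE.
    move=> [Ax Lx]; have [Lnx|Lnx] := pselect (Lambda p_pr n x).
      by right.
    by left.
  case=> [[Ax Lx]|[Ax [Lnx Lx]]]; split => //.
  by move=> /LambdaS.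
rewrite measureU//; first last.
- by apply/seteqP; split => // x [[_ H] [_ []]].
- exact: measurableI.
- by apply: measurableI => //; exact: measurableC.
congr (_ + _)%E; have [A0|A0] := pselect (A 0).
  rewrite diracE mem_set// mule1; congr (eta _); apply/seteqP; split => [x []//|x sx].
  by split=> //=; rewrite (iffRL (digits_eq0 n x)) //; case: sx.
rewrite diracE memNset// mule0 (_ : _ `&` _ = set0) ?measure0//.
apply/seteqP; split => // x [/= Ax [Lx _]]; apply: A0.
by rewrite (iffRL (digits_eq0 n x)) in Ax.
Qed.

Let integral_row_init (h : G -> \bar R) : (forall x, 0 <= h x)%E ->
  (\int[nu']_x h (row_init x) = \int[nu]_x h x + c%:E * h 0%R)%E.
Proof.
move=> h0.
pose cn := NngNum c_ge0.
transitivity (\int[measure_add nu (mscale cn (\d_(0%R : G)))]_x h x)%E.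
  rewrite (_ : (\int[nu']_x _ = \int[pushforward nu' row_init]_x h x)%E).
    apply: eq_measure_integral; first by [].
    move=> ? A mA AT.
    transitivity (nu' (row_init @^-1` A)); first by [].
    by rewrite levy_measure_row_init; exact/esym/measure_addE.
  by rewrite ge0_integral_pushforward ?preimage_setT// => x _.
rewrite ge0_integral_measure_add// ge0_integral_mscale//.
by rewrite integral_dirac// diracT mul1e.
Qed.

Let b j A := fine (convp nu j A).

Let bE j A : ((b j A)%:E = convp nu j A)%E.
Proof.
rewrite /b fineK// ge0_fin_numE ?convolution_power_ge0//.
by apply: le_lt_trans (convolution_power_le _ _ nu_fin) _; rewrite ltry.
Qed.

Let b_ge0 j A : 0 <= b j A.
Proof. by rewrite fine_ge0// convolution_power_ge0. Qed.

(** Binomial coefficients of the k-th convolution power of nu + c delta_0: delta_0 is neutral for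
    convolution, so only the powers of [nu] remain, and [coefS] is Pascal's rule. *)
Let coef k j : R := 'C(k, j)%:R * c ^+ (k - j).

Let coef_ge0 k j : 0 <= coef k j.
Proof. by rewrite mulr_ge0// exprn_ge0. Qed.

Let coefS k j : coef k.+1 j.+1 = coef k j + c * coef k j.+1.
Proof.
rewrite /coef binS subSS natrD mulrDl addrC; congr (_ + _).
have [kj|kj] := leqP k j; last by rewrite mulrCA -exprS subnSK.
by rewrite bin_small ?ltnS// mul0r mul0r mulr0.
Qed.

Lemma convolution_power_row_init k (A : set G) :
  (convp' nu' k (row_init @^-1` A) =
   (\sum_(0 <= j < k.+1) coef k j * b j A)%:E)%E.
Proof.
have row_init0 : row_init 0 = 0 by apply/rowP => j; rewrite !mxE.
elim: k A => [|k IH] A.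
  rewrite big_nat1 /coef bin0 expr0 !mul1r bE !convolution_power0 !diracE.
  by congr ((nat_of_bool _)%:R%:E); apply/idP/idP; rewrite !inE /= row_init0.
rewrite convolution_powerS.
pose h u := (\sum_(0 <= j < k.+1) coef k j * b j [set v : G | A (u + v)])%:E.
have h0 u : (0 <= h u)%E.
  by rewrite lee_fin sumr_ge0// => j _; rewrite mulr_ge0.
transitivity (\int[nu']_x h (row_init x))%E.
  apply: eq_integral => x _; rewrite /h -IH; congr (convp' _ _ _).
  by apply/seteqP; split => y /=; rewrite row_initD.
rewrite integral_row_init//.
have -> : (\int[nu]_x h x = (\sum_(0 <= j < k.+1) coef k j * b j.+1 A)%:E)%E.
  transitivity (\int[nu]_x \sum_(j <- index_iota 0 k.+1)
      ((coef k j)%:E * convp nu j [set v : G | A ((x : G) + v)%R]))%E.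
    apply: eq_integral => x _; rewrite /h -sumEFin; apply: eq_bigr => j _.
    by rewrite EFinM bE.
  rewrite ge0_integral_sum//; last first.
    by move=> j x _; rewrite mule_ge0 ?convolution_power_ge0// lee_fin.
  rewrite -sumEFin; apply: eq_bigr => j _.
  rewrite ge0_integralZl//; last by rewrite lee_fin.
  by rewrite [RHS]EFinM bE convolution_powerS.
have -> : h 0 = (\sum_(0 <= j < k.+1) coef k j * b j A)%:E.
  rewrite /h; congr EFin; apply: eq_bigr => j _; congr (_ * b _ _).
  by apply/seteqP; split => v /=; rewrite add0r.
rewrite -EFinM -EFinD; congr EFin.
(* The coefficient past the diagonal vanishes, so the sum can be extended by one term and its index
   shifted. *)
have last0 : coef k k.+1 = 0 by rewrite /coef bin_small// mul0r.
have -> : \sum_(0 <= j < k.+1) coef k j * b j A =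
    coef k 0 * b 0 A + \sum_(0 <= j < k.+1) coef k j.+1 * b j.+1 A.
  rewrite -(@big_nat_recl _ _ _ _ _ (fun j => coef k j * b j A))//.
  by rewrite [RHS]big_nat_recr//= last0 mul0r addr0.
rewrite [RHS]big_nat_recl//= mulrDr addrCA; congr (_ + _).
  by rewrite /coef !bin0 !subn0 exprS; ring.
rewrite mulr_sumr -big_split /=; apply: eq_bigr => j _.
by rewrite coefS; ring.
Qed.

(** Dividing the binomial formula by k! gives the Cauchy product of the exponential series of [c]
    with the series of [nu]; its factor exp(c) cancels the exp(-c) due to the additional mass at
    0. *)
Lemma compound_poisson_row_init (A : set G) :
  @compound_poisson R _ G' +%R 0 nu' (row_init @^-1` A) =
  @compound_poisson R _ G +%R 0 nu A.
Proof.
have nuT : (nu' setT = nu setT + c%:E)%E.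
  rewrite -[X in nu' X](preimage_setT row_init) levy_measure_row_init.
  by rewrite diracT mule1.
have nufin : nu setT \is a fin_num by rewrite ge0_fin_numE.
rewrite /compound_poisson nuT fineD//= opprD expRD EFinM -muleA; congr (_ * _)%E.
pose f i : R := c ^+ i / i`!%:R.
pose g j : R := b j A / j`!%:R.
have f0 i : 0 <= f i by rewrite divr_ge0// exprn_ge0.
have g0 i : 0 <= g i by rewrite divr_ge0.
have fE : (\sum_(i <oo) (f i)%:E = (expR c)%:E)%E.
  apply/cvg_lim => //; rewrite (_ : (fun _ => _) = EFin \o series (exp_coeff c)).
    by apply/cvg_EFin; [exact: nearW|exact: is_cvg_series_exp_coeff].
  by apply/funext => N; rewrite /= sumEFin.
transitivity ((expR (- c))%:E * \sum_(k <oo) (\sum_(0 <= j < k.+1) f (k - j)%N * g j)%:E)%E.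
  congr (_ * _)%E; apply: eq_eseriesr => k _.
  rewrite convolution_power_row_init -EFinM; congr EFin.
  rewrite mulr_sumr !big_mkord; apply: eq_bigr => -[j] /=; rewrite ltnS => jk _.
  have fne i : i`!%:R != 0 :> R by rewrite pnatr_eq0 -lt0n fact_gt0.
  have := congr1 (fun m => m%:R : R) (bin_fact jk); rewrite !natrM => binE.
  rewrite /coef /f /g -binE; field.
  by rewrite !fne pnatr_eq0 -lt0n bin_gt0 jk.
rewrite (nneseries_cauchy_product f0 g0 fE) muleA -EFinM [X in X%:E]mulrC expRxMexpNx_1 mul1e.
by apply: eq_eseriesr => j _; rewrite /g mulrC EFinM bE.
Qed.

End Projection.

(** * Existence *)

Lemma exists_mfun (d d' : measure_display) (T : measurableType d)
    (T' : measurableType d') (f : T -> T') :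
  measurable_fun setT f -> exists F : {mfun T >-> T'}, F = f :> (T -> T').
Proof.
move=> mf; pose F : {mfun T >-> T'} := HB.pack f (isMeasurableFun.Build _ _ _ _ f mf).
by exists F.
Qed.

Lemma exists_mfun_family (d d' : measure_display) (T : measurableType d)
    (T' : measurableType d') (f : nat -> T -> T') :
  (forall n, measurable_fun setT (f n)) ->
  exists F : nat -> {mfun T >-> T'}, forall n, F n = f n :> (T -> T').
Proof.
move=> mf; have /choice [F FE] := fun n => exists_mfun (mf n).
by exists F.
Qed.

Lemma row_law_ext (d : measure_display) (T : measurableType d) (R : realType)
    (P : probability T R) n (f : T -> 'rV[int]_n)
    (mu : {measure set 'rV[int]_n -> \bar R}) :
  measurable_fun setT f -> (forall l, P (f @^-1` [set l]) = mu [set l]) ->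
  forall A, P (f @^-1` A) = mu A.
Proof.
move=> mf H A; have [F FE] := exists_mfun mf.
rewrite (measure_esum mu) -FE -[LHS]/(distribution P F A).
rewrite [LHS](measure_esum (distribution P F)); apply: eq_esum => l _.
by rewrite -H -FE.
Qed.

Section CompoundPoissonSequence.
Context (p : nat) (p_pr : prime p) (R : realType).
Variable eta : {measure set (padic p_pr) -> \bar R}.
Hypothesis eta_levy : is_levy_measure eta.
Local Notation cp n := (@compound_poisson R _ 'rV[int]_n +%R 0 (@levy_measure p p_pr R eta n)).

(** Consistency brings the total mass down to dimension 0. There Lambda_0 is the whole group, so the
    projected measure is zero and only the term k = 0 remains. *)
Lemma compound_poissonT n : cp n setT = 1%E.
Proof.
elim: n => [|n IH]; last first.
  rewrite -IH -[RHS](compound_poisson_row_init eta_levy setT).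
  by rewrite preimage_setT.
pose nu : {measure set 'rV[int]_0 -> \bar R} := @levy_measure p p_pr R eta 0.
have nu0 : nu setT = 0%E.
  rewrite -[LHS]/(eta (_ `&` _)) (_ : _ `&` _ = set0) ?measure0//.
  by apply/seteqP; split => // x [_ H]; apply: H.
rewrite /compound_poisson -/nu nu0 /= oppr0 expR0 mul1e.
rewrite (nneseries_recl (P := xpredT))//; last first.
  by move=> k _; apply: mule_ge0; [rewrite lee_fin|exact: (convolution_power_ge0 nu)].
rewrite eseries0; last first.
  move=> [|k] // _ _; rewrite [X in (_ * X)%E](_ : _ = 0%E) ?mule0//.
  apply/eqP; rewrite eq_le (@convolution_power_ge0 _ _ nu) andbT.
  have := @convolution_power_le _ _ nu k.+1 setT; rewrite nu0 expr0n /=.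
  by apply; rewrite ltry.
by rewrite adde0 convolution_power0 diracT fact0 invr1 mule1.
Qed.

Let cp_fin n A : cp n A \is a fin_num.
Proof.
rewrite ge0_fin_numE ?measure_ge0//; apply: (@le_lt_trans _ _ 1%E).
  by rewrite -(compound_poissonT n); apply: le_measure; rewrite ?inE.
by rewrite ltry.
Qed.

(** A bijection is wanted: [encodeK] makes the children of a prefix exhaust all integers, and
    [decodeK] makes them distinct. *)
Let decode (n : nat) : int := if odd n then Negz n./2 else Posz n./2.

Let encode (z : int) : nat := match z with Posz n => n.*2 | Negz n => n.*2.+1 end.

Let encodeK : cancel encode decode.
Proof.
move=> [n|n]; rewrite /encode /decode.
  by rewrite odd_double doubleK.
by rewrite /= odd_double /= uphalf_double.
Qed.

Let decodeK : cancel decode encode.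
Proof.
move=> n; rewrite /encode /decode; case: ifP => on.
  by rewrite -[RHS]odd_double_half on.
by rewrite -[RHS]odd_double_half on.
Qed.

Let rowof n (s : seq nat) : 'rV[int]_n := \row_(j < n) decode (nth 0%N s j).

(** The dimension is a separate argument, so that equations on [size s] do not have to be rewritten
    inside a row type. *)
Let W n s : R := fine (cp n [set rowof n s]).

Let w s := W (size s) s.

(** The fibre of [row_init] over a prefix is the disjoint union of its children, so consistency and
    countable additivity give the sum. *)
Let w_children s : series (fun k => w (rcons s k)) @ \oo --> w s.
Proof.
set n := size s.
have wE k : w (rcons s k) = W n.+1 (rcons s k) by rewrite /w size_rcons.
rewrite (_ : (fun k => _) = fun k => W n.+1 (rcons s k)); last exact/funext.
rewrite (_ : series _ = fun N =>
    fine (\sum_(0 <= k < N) cp n.+1 [set rowof n.+1 (rcons s k)])%E); last first.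
  by apply/funext => N; rewrite /series /= sum_fine.
apply: fine_cvg; rewrite fineK//.
rewrite -(compound_poisson_row_init eta_levy).
have -> : @row_init n @^-1` [set rowof n s] =
    \bigcup_k [set rowof n.+1 (rcons s k)].
  apply/seteqP; split => [l /= /rowP lE|l [k _ ->]].
    exists (encode (l 0 ord_max)) => //=; apply/rowP => j; rewrite !mxE nth_rcons.
    case: ltngtP => [jn|jn|jn].
    - by have := lE (Ordinal jn); rewrite !mxE /= => <-; congr (l _ _); exact/val_inj.
    - by have := ltn_ord j; rewrite ltnS leqNgt jn.
    - by rewrite encodeK; congr (l _ _); exact/val_inj.
  by apply/rowP => j; rewrite !mxE nth_rcons /= ltn_ord.
apply: measure_semi_sigma_additive => //.
apply/trivIsetP => i j _ _ ij; apply/seteqP; split => // l [/= ->] /rowP /(_ ord_max).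
rewrite !mxE !nth_rcons /= ltnn eqxx => /(can_inj decodeK) E.
by move: ij; rewrite E eqxx.
Qed.

Lemma compound_poisson_sequence : exists (d : measure_display)
  (T : measurableType d) (P : probability T R) (Y : nat -> T -> int),
  (forall n, measurable_fun setT (Y n)) /\
  forall n (A : set 'rV[int]_n), P [set t | A (\row_(j < n) Y j t)] = cp n A.
Proof.
have [d [T [P [X [mX _ XE]]]]] : exists (d : measure_display)
    (T : measurableType d) (P : probability T R) (X : nat -> T -> nat),
    [/\ forall n, measurable_fun setT (X n),
    forall n t, X n t != 0%N -> 0 < w (mkseq (fun i => X i t) n.+1) &
    forall s, P [set t | mkseq (fun i => X i t) (size s) = s] = (w s)%:E].
  apply: random_sequence.
  - by move=> s; rewrite fine_ge0.
  - rewrite /w /W /= (_ : [set _] = setT) ?compound_poissonT//.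
    by apply/seteqP; split => // l _; apply/rowP => -[].
  - exact: w_children.
exists d, T, P, (fun j t => decode (X j t)).
have mY n : measurable_fun setT (fun t => decode (X n t)).
  by apply: measurableT_comp => //.
split=> // n.
apply: (row_law_ext (f := fun t => \row_(j < n) decode (X j t)) (mu := cp n)).
  exact: (@measurable_row _ _ n (fun j t => decode (X j t)) mY).
move=> l; pose s := mkseq (fun j => encode (if insub j is Some i then l 0 i else 0)) n.
have sn : size s = n by rewrite size_mkseq.
have lE : l = rowof n s.
  apply/rowP => j; rewrite mxE nth_mkseq// encodeK.
  by case: insubP => [i _ /val_inj ->|]//; rewrite ltn_ord.
rewrite lE -[RHS]fineK; last exact: cp_fin.
rewrite -/(W n s).
have -> : W n s = w s by rewrite /w sn.
rewrite -XE sn; congr (P _); apply/seteqP; split => t /=.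
  move/rowP => H; apply: (@eq_from_nth _ 0%N); first by rewrite size_mkseq sn.
  rewrite size_mkseq => i ni; rewrite nth_mkseq//.
  by have := H (Ordinal ni); rewrite !mxE => /(can_inj decodeK).
by move=> <-; apply/rowP => j; rewrite !mxE nth_mkseq.
Qed.

End CompoundPoissonSequence.

(** * Independent uniform digits *)

Section UniformDigits.
Context (p : nat) (R : realType).
Hypothesis p_gt0 : (0 < p)%N.

Let w (s : seq nat) : R := \prod_(i < size s) ((nth 0%N s i < p)%N%:R / p%:R).

Let p_neq0 : p%:R != 0 :> R.
Proof. by rewrite pnatr_eq0 -lt0n. Qed.

Let w_rcons s k : w (rcons s k) = w s * ((k < p)%N%:R / p%:R).
Proof.
rewrite /w size_rcons big_ord_recr /= nth_rcons ltnn eqxx; congr (_ * _).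
by apply: eq_bigr => i _; rewrite nth_rcons ltn_ord.
Qed.

Let w_ge0 s : 0 <= w s.
Proof. by apply: prodr_ge0 => i _; rewrite divr_ge0. Qed.

Let w_gt0 s : 0 < w s -> forall i, (i < size s)%N -> (nth 0%N s i < p)%N.
Proof.
move=> ws i si; rewrite ltnNge; apply/negP => pi; move: ws.
by rewrite /w (bigD1 (Ordinal si))//= ltnNge pi !mul0r ltxx.
Qed.

Let w_children s : series (fun k => w (rcons s k)) @ \oo --> w s.
Proof.
apply: cvg_near_cst; near=> N.
have pN : (p <= N)%N by near: N; exact: nbhs_infty_ge.
rewrite /series /= (big_cat_nat (n := p))//= [X in _ + X]big1_seq ?addr0; last first.
  move=> k /=; rewrite mem_index_iota w_rcons => /andP[pk _].
  by rewrite ltnNge pk !mul0r mulr0.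
rewrite big_mkord (eq_bigr (fun=> w s / p%:R)); last first.
  by move=> k _; rewrite w_rcons ltn_ord mul1r.
by rewrite sumr_const card_ord -[LHS]mulr_natr mulfVK.
Unshelve. all: by end_near.
Qed.

Lemma uniform_digits : exists (d : measure_display)
  (T : measurableType d) (P : probability T R) (X : nat -> T -> nat),
  [/\ forall n, measurable_fun setT (X n),
   forall j k, (k < p)%N -> P (X j @^-1` [set k]) = ((p%:R)^-1)%:E &
   forall n (B : nat -> set nat),
     P [set t | forall j, (j < n)%N -> B j (X j t)] =
     (\prod_(j < n) P (X j @^-1` B j))%E].
Proof.
have [d [T [P [X [mX Xw XE]]]]] : exists (d : measure_display)
    (T : measurableType d) (P : probability T R) (X : nat -> T -> nat),
    [/\ forall n, measurable_fun setT (X n),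
    forall n t, X n t != 0%N -> 0 < w (mkseq (fun i => X i t) n.+1) &
    forall s, P [set t | mkseq (fun i => X i t) (size s) = s] = (w s)%:E].
  apply: random_sequence => //.
  by rewrite /w big_ord0.
exists d, T, P, X.
(* Prefixes with an entry outside the digits have weight 0, so the bound holds at every point and
   [q] below can take values in a finite type. *)
have Xp n t : (X n t < p)%N.
  have [->//|/Xw /w_gt0 /(_ n)] := eqVneq (X n t) 0%N.
  by rewrite size_mkseq ltnSn nth_mkseq//; apply.
(* The first [n] digits are uniform on the functions from ['I_n] to ['I_p], and the indicator of a
   box is a product over coordinates; distributivity then factors the sum. *)
have box n (B : nat -> set nat) :
    P [set t | forall j, (j < n)%N -> B j (X j t)] =
    (\prod_(j < n) \sum_(k < p) (`[< B j k >])%:R / p%:R)%:E.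
  pose q t := [ffun j : 'I_n => Ordinal (Xp j t)].
  have qE f : q @^-1` [set f] =
      [set t | mkseq (fun i => X i t) n =
        mkseq (fun i => if insub i is Some j then f j : nat else 0%N) n].
    apply/seteqP; split => t /=.
      move=> <-; apply/eq_in_map => i; rewrite mem_iota /= add0n => ni.
      by rewrite insubT /= ffunE.
    move=> H; apply/ffunP => j; rewrite ffunE; apply/val_inj => /=.
    have := congr1 (nth 0%N ^~ j) H; rewrite !nth_mkseq// => ->.
    by case: insubP => [i _ /val_inj ->|]//; rewrite ltn_ord.
  have Pq f : P (q @^-1` [set f]) = ((p%:R)^-1 ^+ n)%:E.
    rewrite qE; set s := mkseq _ n; have sn : size s = n by rewrite size_mkseq.
    rewrite -{1}sn XE /w sn; congr EFin.
    rewrite -[X in _ = _ ^+ X]card_ord -prodr_const; apply: eq_bigr => j _.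
    rewrite nth_mkseq//; case: insubP => [i _ _|]; last by rewrite ltn_ord.
    by rewrite ltn_ord mul1r.
  have mq f : measurable (q @^-1` [set f]).
    rewrite (_ : _ @^-1` _ = \bigcap_(j in [set: 'I_n]) X j @^-1` [set (f j : nat)]).
      apply: fin_bigcap_measurable => // j _.
      by rewrite -[X in measurable X]setTI; exact: mX.
    apply/seteqP; split => [t /= <- j _ /=|t H]; first by rewrite ffunE.
    by apply/ffunP => j; rewrite ffunE; apply/val_inj; exact: H.
  pose E := [set t | forall j, (j < n)%N -> B j (X j t)].
  have mE : measurable E.
    rewrite (_ : E = \bigcap_(j in [set: 'I_n]) X j @^-1` B j).
      apply: fin_bigcap_measurable => // j _.
      by rewrite -[X in measurable X]setTI; exact: mX.
    by apply/seteqP; split => [t Et j _ |t Et j jn]; [exact: Et|exact: (Et (Ordinal jn))].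
  rewrite -[LHS]/(P E) -[in LHS](setIT E) -integral_indic//.
  pose h (f : {ffun 'I_n -> 'I_p}) : R := \prod_(j < n) (`[< B j (f j) >])%:R.
  transitivity (\int[P]_x (h (q x))%:E)%E.
    apply: eq_integral => t _; congr EFin; rewrite indicE /h.
    have [Et|Et] := pselect (E t).
      by rewrite mem_set// big1// => j _; rewrite ffunE /= asboolT//; exact: Et.
    rewrite memNset//; have [j [jn nB]] : exists j, (j < n)%N /\ ~ B j (X j t).
      by apply: contrapT => H; apply: Et => j jn; apply: contrapT => nB; apply: H; exists j.
    by rewrite (bigD1 (Ordinal jn))//= ffunE /= asboolF// mul0r.
  transitivity (\sum_(f : {ffun 'I_n -> 'I_p}) (h f)%:E * P (q @^-1` [set f]))%E.
    apply: (integral_finite_range (mu := P) (h := h) mq) => f; right.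
    by rewrite [X in (X < _)%E](_ : _ = P (q @^-1` [set f]))// Pq ltry.
  under eq_bigr do rewrite Pq -EFinM.
  rewrite sumEFin; congr EFin.
  rewrite bigA_distr_bigA /=; apply: eq_bigr => f _.
  rewrite /h big_split /= prodr_const card_ord; congr (_ * _).
(* A box with a single constrained coordinate gives the marginal law. *)
have one n (B : set nat) : P (X n @^-1` B) = (\sum_(k < p) (`[< B k >])%:R / p%:R)%:E.
  have := box n.+1 (fun j => if j == n then B else setT).
  rewrite big_ord_recr /= eqxx big1 ?mul1r => [<-|j _].
    congr (P _); apply/seteqP; split => [t Bt j _|t /(_ n (ltnSn n))].
      by case: eqP => [->|].
    by rewrite eqxx.
  under eq_bigr do rewrite (ltn_eqF (ltn_ord j)) asboolT// mul1r.
  by rewrite sumr_const card_ord -[LHS]mulr_natr mulVf.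
split.
- exact: mX.
- move=> j k kp; rewrite one; congr EFin.
  rewrite (bigD1 (Ordinal kp))//= asboolT// mul1r big1 ?addr0// => i ik.
  rewrite asboolF ?mul0r// => /= E; case/eqP: ik.
  exact/val_inj.
- move=> n B; rewrite box.
  by under [RHS]eq_bigr do rewrite one; rewrite prodEFin.
Qed.

End UniformDigits.

Section ProductProbability.
Context (d1 d2 : measure_display) (T1 : measurableType d1) (T2 : measurableType d2).
Context (R : realType) (P1 : probability T1 R) (P2 : probability T2 R).

Definition product_probability : set (T1 * T2) -> \bar R := (P1 \x P2)%E.

HB.instance Definition _ := Measure.on product_probability.

Lemma product_probabilityE A1 A2 : measurable A1 -> measurable A2 ->
  product_probability (A1 `*` A2) = (P1 A1 * P2 A2)%E.
Proof. by move=> mA1 mA2; exact: product_measure1E. Qed.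

Let product_probabilityT : product_probability setT = 1%E.
Proof. by rewrite -setXTT product_probabilityE// !probability_setT mule1. Qed.

HB.instance Definition _ :=
  Measure_isProbability.Build _ _ _ product_probability product_probabilityT.

End ProductProbability.

(** [None] is the index of the whole sequence Y and [Some j] that of U_j. Padding with factors 1
    replaces an arbitrary finite index set by an initial segment. *)
Lemma prod_fset_option (R : realType) (J : {fset option nat}) n
    (g : option nat -> \bar R) :
  (forall j, Some j \in J -> (j < n)%N) -> (forall i, i \notin J -> g i = 1%E) ->
  (\prod_(i <- J) g i = g None * \prod_(j < n) g (Some (j : nat)))%E.
Proof.
move=> Jn g1; pose s := None :: [seq Some j | j <- iota 0 n].
have us : uniq s.
  rewrite /= map_inj_uniq ?iota_uniq ?andbT; last by move=> ? ? [].
  by apply/mapP => -[].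
have Js : perm_eq J [seq i <- s | i \in J].
  apply: uniq_perm; rewrite ?fset_uniq ?filter_uniq// => i.
  rewrite mem_filter; case: (boolP (i \in J)) => //= iJ; symmetry.
  case: i iJ => [j|] iJ //; rewrite inE /=; apply/mapP; exists j => //.
  by rewrite mem_iota /= add0n Jn.
rewrite (perm_big _ Js) big_filter big_mkcond /=.
rewrite (eq_bigr g) => [|i _]; last by case: ifPn => // /g1.
by rewrite big_cons big_map -(big_mkord xpredT (fun j => g (Some j))) /index_iota subn0.
Qed.

Section Existence.
Context (R : realType) (p : nat) (p_pr : prime p) (r : nat).
Variable eta : {measure set (padic p_pr) -> \bar R}.
Hypothesis eta_levy : is_levy_measure eta.

Lemma admissible_exists : exists (d : measure_display) (T : measurableType d)
  (P : probability T R) (U Y : nat -> {RV P >-> int}), admissible r eta U Y.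
Proof.
have [d1 [T1 [P1 [X [mX X1 Xbox]]]]] := uniform_digits R (prime_gt0 p_pr).
have [d2 [T2 [P2 [Z [mZ Zlaw]]]]] := compound_poisson_sequence eta_levy.
pose P : probability (T1 * T2)%type R := product_probability P1 P2.
have PE A1 A2 : measurable A1 -> measurable A2 -> P (A1 `*` A2) = (P1 A1 * P2 A2)%E.
  exact: product_probabilityE.
pose u j (k : nat) : int := if (j < r)%N then 0 else Posz k.
have [U UE] : exists U : nat -> {mfun (T1 * T2)%type >-> int},
    forall j, U j = (fun t => u j (X j t.1)) :> (_ -> _).
  apply: exists_mfun_family => j.
  by apply: measurableT_comp => //; apply: measurableT_comp.
have [Y YE] : exists Y : nat -> {mfun (T1 * T2)%type >-> int},
    forall j, Y j = (fun t => Z j t.2) :> (_ -> _).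
  by apply: exists_mfun_family => j; apply: measurableT_comp.
have mXB j (B : set nat) : measurable (X j @^-1` B).
  by rewrite -[X in measurable X]setTI; exact: mX.
exists _, (T1 * T2)%type, P, U, Y; split.
- move=> J E HE.
  have /choice [B BE] : forall j, exists B : set nat,
      (Some j \in J -> E (Some j) = (X j @^-1` B) `*` setT) /\
      (Some j \notin J -> B = setT).
    move=> j; have [jJ|jJ] := boolP (Some j \in J); last by exists setT.
    have [B _ <-] := HE _ jJ; exists (u j @^-1` B); split => // _.
    by rewrite setTI; apply/seteqP; split => -[t1 t2]; rewrite /= UE // => -[].
  have [F [mF [FJ FnJ]]] : exists F : set T2, measurable F /\
      ((None \in J -> E None = setT `*` F) /\ (None \notin J -> F = setT)).
    have [NJ|NJ] := boolP (None \in J); last by exists setT.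
    (* Every event generated by Y depends on the second factor of the sample space only. *)
    suff : sigma_generated_seq Y `<=` preimage_set_system setT snd (@measurable _ T2).
      by move=> /(_ _ (HE _ NJ)) [F mF <-]; exists F; split => //; split.
    apply: smallest_sub; first exact/sigma_algebra_preimage/sigma_algebra_measurable.
    move=> _ [j _ [A mA <-]]; exists (Z j @^-1` A).
      by rewrite -[X in measurable X]setTI; exact: mZ.
    by rewrite !setTI; apply/seteqP; split => -[t1 t2]; rewrite /= YE.
  pose n := (\max_(i <- J) (if i is Some j then j.+1 else 0))%N.
  have Jn j : Some j \in J -> (j < n)%N.
    move=> jJ; apply: (@leq_bigmax_seq _ _ predT
      (fun i => if i is Some j then j.+1 else 0%N) (Some j)) => //.
  have -> : \bigcap_(i in [set` J]) E i =
      [set t | forall j, (j < n)%N -> B j (X j t)] `*` F.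
    apply/seteqP; split => [[t1 t2] H|[t1 t2] [/= H1 H2] [j|] /= iJ].
    - split => /= [j jn|].
        have [/[dup] jJ /(H _)|/(proj2 (BE j)) ->//] := boolP (Some j \in J).
        by rewrite (proj1 (BE j) jJ) => -[].
      have [/[dup] jJ /(H _)|/FnJ ->//] := boolP (None \in J).
      by rewrite (FJ jJ) => -[].
    - by rewrite (proj1 (BE j) iJ); split => //=; apply: H1; exact: Jn.
    - by rewrite (FJ iJ).
  rewrite PE//; last first.
    rewrite (_ : [set t | _] = \bigcap_(j in [set: 'I_n]) X j @^-1` B j).
      exact: fin_bigcap_measurable.
    by apply/seteqP; split => [t Et j _|t Et j jn]; [exact: Et|exact: (Et (Ordinal jn))].
  rewrite Xbox muleC.
  pose g i := if i is Some j then P1 (X j @^-1` B j) else P2 F.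
  rewrite (eq_big_seq g) => [|[j|] iJ]; first last.
  - by rewrite (FJ iJ) PE// probability_setT mul1e.
  - by rewrite (proj1 (BE j) iJ) PE// probability_setT mule1.
  rewrite (prod_fset_option Jn)// => -[j|] iJ /=.
    by rewrite (proj2 (BE j) iJ) preimage_setT probability_setT.
  by rewrite (FnJ iJ) probability_setT.
- by move=> j jr t; rewrite UE /u jr.
- move=> j rj k kp; rewrite -(X1 j k kp).
  rewrite (_ : _ @^-1` _ = (X j @^-1` [set k]) `*` setT).
    by rewrite PE// probability_setT mule1.
  apply/seteqP; split => -[t1 t2]; rewrite /= UE /u ltnNge rj /=.
    by move=> [].
  by move=> [->].
- move=> n; split.
    by apply: (@measurable_row _ _ n.+1 (fun j t => Y j t)) => j.
  move=> A _; rewrite levy_projectionE -Zlaw.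
  rewrite (_ : _ @^-1` _ = setT `*` [set t | A (\row_(j < n.+1) Z j t)]).
    rewrite PE// ?probability_setT ?mul1e//.
    have := @measurable_row _ _ n.+1 Z mZ measurableT A I.
    by rewrite setTI.
  have rE t : \row_(j < n.+1) Y j t = \row_(j < n.+1) Z j t.2.
    by apply/rowP => j; rewrite !mxE YE.
  by apply/seteqP; split => t; rewrite /= rE // => -[].
Qed.

End Existence.

(** * The law of phi(U + a + Y) *)

Lemma exists_pushforward (d d' : measure_display) (T : measurableType d)
    (T' : measurableType d') (R : realType) (mu : {measure set T -> \bar R})
    (f : T -> T') : measurable_fun setT f ->
  exists m : {measure set T' -> \bar R}, forall A, m A = mu (f @^-1` A).
Proof.
move=> mf.
unshelve eexists (pushforward mu f : {measure set T' -> \bar R}) => //.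
Qed.

Section Law.
Context (R : realType) (p : nat) (p_pr : prime p) (r : nat).
Local Notation Delta := (padic p_pr).

(** Entries that already lie in the digit range produce no carry. *)
Lemma cyl_phi (y : nat -> int) (c : Delta) n :
  (forall j, (j < n)%N -> 0 <= y j < p%:Z) ->
  cyl n c (phi p_pr y) <-> forall j, (j < n)%N -> y j = Posz (c j).
Proof.
(* [x] copies [y] below [n]; later entries may leave the digit range and are then replaced by 0. *)
move=> yp; pose x : Delta := Padic p_pr (fun j =>
  if pselect (`|y j| < p)%N is left jp then Ordinal jp else Ordinal (prime_gt0 p_pr)).
have xE j : (j < n)%N -> Posz (x j) = y j.
  move=> /yp /andP[y0 yltp]; rewrite /x /=; case: pselect => [jp|[]] /=.
    by rewrite gez0_abs.
  by rewrite -ltz_nat gez0_abs.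
have phiE j : (j < n)%N -> phi p_pr y j = x j.
  move: j; apply/psum_inj; rewrite -[RHS]psum_mod /psum partial_sum_phi.
  congr (_ %% _)%Z.
  by apply: eq_bigr => -[i ni] _ /=; rewrite xE.
split=> H j jn; first by rewrite -xE// -phiE// H.
by rewrite phiE//; apply/val_inj; have := xE j jn; rewrite H// => -[].
Qed.

Definition digit_mass (j k : nat) : R :=
  if (j < r)%N then (k == 0%N)%:R else (p%:R)^-1.

Section Admissible.
Context (d : measure_display) (T : measurableType d) (P : probability T R).
Variables (eta : {measure set Delta -> \bar R}) (U Y : nat -> {RV P >-> int}).
Hypothesis adm : admissible r eta U Y.

Let phiU t := phi p_pr (fun j => U j t).
Let phiY t := phi p_pr (fun j => Y j t).

Let mphiU : measurable_fun setT phiU.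
Proof. exact: (@measurable_phi p p_pr _ _ (fun j t => U j t)). Qed.

Let mphiY : measurable_fun setT phiY.
Proof. exact: (@measurable_phi p p_pr _ _ (fun j t => Y j t)). Qed.

Let mfun_preimage (d' : measure_display) (T' : measurableType d') (f : T -> T') A :
  measurable_fun setT f -> measurable A -> measurable (f @^-1` A).
Proof. by move=> mf mA; rewrite -[X in measurable X]setTI; exact: mf. Qed.

Let mU j (B : set int) : measurable (U j @^-1` B).
Proof. exact: mfun_preimage. Qed.

Let P_digit j k : (k < p)%N -> P (U j @^-1` [set Posz k]) = (digit_mass j k)%:E.
Proof.
move=> kp; have [_ U0 Uu _] := adm; rewrite /digit_mass.
have [jr|jr] := ltnP j r; last by rewrite Uu.
case: eqP => [->|k0].
  rewrite (_ : _ @^-1` _ = setT) ?probability_setT//.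
  by apply/seteqP; split => // t _ /=; rewrite U0.
rewrite (_ : _ @^-1` _ = set0) ?measure0//; apply/seteqP; split => // t /=.
by rewrite U0// => -[] /esym.
Qed.

(** For j >= r only the masses 1/p of p values are prescribed, but these add up to 1, so all other
    values are negligible together. *)
Let P_out j : P (U j @^-1` (~` [set z | 0 <= z < p%:Z])) = 0%E.
Proof.
have [_ U0 _ _] := adm.
have [jr|rj] := ltnP j r.
  rewrite (_ : _ @^-1` _ = set0) ?measure0//; apply/seteqP; split => // t /=.
  by rewrite U0// ltz_nat prime_gt0// lexx.
rewrite preimage_setC; transitivity (1 - P (U j @^-1` [set z | (0 <= z < p%:Z)%R]))%E.
  exact: (probability_setC P (mU j _)).
rewrite (_ : _ @^-1` _ = \big[setU/set0]_(k < p) U j @^-1` [set Posz k]); last first.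
  rewrite -(bigcup_mkord p (fun k => U j @^-1` [set Posz k])).
  apply/seteqP; split => t /= => [/andP[u0 up]|[k /= kp ->]].
    by exists `|U j t|%N; rewrite /= ?gez0_abs// -ltz_nat gez0_abs.
  by rewrite ltz_nat.
rewrite (measure_bigsetU_ord P); first last.
- apply/trivIsetP => a b _ _ ab; apply/seteqP; split => // t [/= ->] [] /val_inj E.
  by move: ab; rewrite E eqxx.
- by move=> k; exact: mU.
rewrite (eq_bigr (fun=> ((p%:R)^-1)%:E)) => [|k _]; last first.
  transitivity (digit_mass j k)%:E; first exact: P_digit.
  by rewrite /digit_mass ltnNge rj.
have p1 : (p%:R)^-1 *+ p = 1 :> R.
  by rewrite -[LHS]mulr_natr mulVf// pnatr_eq0 -lt0n prime_gt0.
by rewrite sumEFin sumr_const card_ord p1 subee.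
Qed.

Let sigma_Y_measurable (F : set T) : sigma_generated_seq Y F -> measurable F.
Proof.
apply: smallest_sub; first exact: sigma_algebra_measurable.
by move=> _ [j _ [A mA <-]]; rewrite setTI; exact: mfun_preimage.
Qed.

Let joint_digits n (c : Delta) (F : set T) : sigma_generated_seq Y F ->
  P ([set t | forall j, (j < n)%N -> U j t = Posz (c j)] `&` F) =
  ((\prod_(j < n) digit_mass j (c j))%:E * P F)%E.
Proof.
move=> sF; have [indep _ _ _] := adm.
pose E i := if i is Some j then U j @^-1` [set Posz (c j)] else F.
pose J := [fset i | i in None :: [seq Some j | j <- iota 0 n]]%fset.
have JE i : (i \in J) = if i is Some j then (j < n)%N else true.
  rewrite !inE; case: i => [j|]//=; apply/mapP/idP => [[k + [->]]|jn].
    by rewrite mem_iota.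
  by exists j => //; rewrite mem_iota.
rewrite (_ : _ `&` _ = \bigcap_(i in [set` J]) E i); last first.
  apply/seteqP; split => [t [H Ft] [j|] /=|t H].
  - by rewrite JE => /H.
  - by [].
  - split; last by have := H None; rewrite /= JE; apply.
    by move=> j jn; have := H (Some j); rewrite /= JE; apply.
rewrite indep; last by move=> [j|] _ //; exists [set Posz (c j)]; rewrite ?setTI.
pose g i := if i \in J then P (E i) else 1%E.
rewrite (eq_big_seq g) => [|i iJ]; last by rewrite /g iJ.
rewrite (@prod_fset_option _ J n g); first last.
- by move=> i /negbTE; rewrite /g => ->.
- by move=> j; rewrite JE.
rewrite {1}/g JE muleC -prodEFin; congr (_ * _)%E; apply: eq_bigr => j _.
by rewrite /g JE ltn_ord P_digit.
Qed.

(** Off the null set [N], where some U_j is not a digit, [phi] carries nothing and the cylinder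
    event is an event on the U_j themselves. *)
Let joint_cyl n (c : Delta) (F : set T) : sigma_generated_seq Y F ->
  P (phiU @^-1` cyl n c `&` F) = ((\prod_(j < n) digit_mass j (c j))%:E * P F)%E.
Proof.
move=> sF; rewrite -joint_digits//.
have mF := sigma_Y_measurable sF.
set A := [set t | _].
pose N := \bigcup_j U j @^-1` (~` [set z | 0 <= z < p%:Z]).
have mN : measurable N by apply: bigcup_measurable => j _; exact: mU.
have N0 : P N = 0%E.
  apply: measure_negligible => //; apply: negligible_bigcup => j.
  by apply/negligibleP; [exact: mU|exact: P_out].
have mC : measurable (phiU @^-1` cyl n c).
  by apply: mfun_preimage => //; exact: measurable_cyl.
have mA : measurable A.
  rewrite (_ : A = \bigcap_(j in `I_n) U j @^-1` [set Posz (c j)]).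
    apply: fin_bigcap_measurable => [|j _]; first exact: finite_II.
    exact: mU.
  by apply/seteqP; split.
have AE t : ~ N t -> (phiU @^-1` cyl n c) t <-> A t.
  move=> Nt; apply: cyl_phi => j jn; apply: contrapT => Ut; apply: Nt.
  by exists j.
have AC : A `<=` phiU @^-1` cyl n c.
  move=> t At; apply/cyl_phi => // j jn.
  by rewrite At// lez_nat ltz_nat ltn_ord.
rewrite (_ : phiU @^-1` cyl n c `&` F = (A `&` F) `|` (phiU @^-1` cyl n c `&` F `&` N)).
  apply: measureU0; [exact: measurableI|do 2?apply: measurableI => //|].
  apply: subset_measure0 N0 => //; first by do 2?apply: measurableI => //.
apply/seteqP; split => [t [Ct Ft]|t [[At Ft]|[[]]]//]; last by split => //; exact: AC.
have [Nt|Nt] := pselect (N t); [by right|left; split => //; exact/AE].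
Qed.

(** [measurable_phi] is applied to [T] equipped with the smaller sigma-algebra generated by the
    Y_j. *)
Let sigma_phiY B : measurable B -> sigma_generated_seq Y (phiY @^-1` B).
Proof.
move=> mB; pose T' := g_sigma_algebraType (\bigcup_n sigma_generated (Y n)).
have mY j : measurable_fun setT (Y j : T' -> int).
  by move=> _ A mA; apply: sub_sigma_algebra; exists j => //; exists A.
have := @measurable_phi p p_pr _ T' (fun j t => Y j t) mY measurableT B mB.
by rewrite setTI.
Qed.

Let law_cyl n c : P (phiU @^-1` cyl n c) = (\prod_(j < n) digit_mass j (c j))%:E.
Proof.
rewrite -[_ @^-1` _]setIT joint_cyl ?probability_setT ?mule1//.
exact: (@measurableT _ (g_sigma_algebraType _)).
Qed.

(** For fixed [B], both sides are finite measures in [A], and they agree on cylinders by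
    [joint_cyl]. *)
Let indep_phi A B : measurable A -> measurable B ->
  P (phiU @^-1` A `&` phiY @^-1` B) = (P (phiU @^-1` A) * P (phiY @^-1` B))%E.
Proof.
move=> mA mB; have mF : measurable (phiY @^-1` B) by exact: mfun_preimage.
have Ffin : P (phiY @^-1` B) \is a fin_num by rewrite fin_num_measure.
pose k := NngNum (fine_ge0 (measure_ge0 P (phiY @^-1` B))).
have [m1 m1E] := exists_pushforward (mrestr P mF) mphiU.
have [m2 m2E] := exists_pushforward (mscale k P) mphiU.
transitivity (m1 A); first by rewrite m1E.
rewrite (@padic_measure_unique _ _ _ m1 m2)//.
- by rewrite m2E /= /mscale /= fineK// muleC.
- rewrite m1E preimage_setT /= /mrestr setTI.
  by rewrite -ge0_fin_numE.
- move=> n c; rewrite m1E m2E /= /mrestr /mscale /= fineK// law_cyl muleC.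
  by rewrite joint_cyl//; exact: sigma_phiY.
Qed.

(** Adding [h] from Lambda_r to the centre of a cylinder keeps its first r digits, and from index r
    on [digit_mass] is the same for all digits. *)
Let law_haar (mu : probability Delta R) : (forall A, mu A = P (phiU @^-1` A)) ->
  @is_normalized_haar R _ Delta +%R (Lambda p_pr r) mu.
Proof.
move=> muE; split.
  rewrite muE LambdaE law_cyl big1// => j _.
  by rewrite /digit_mass ltn_ord.
move=> h Lh A mA; rewrite padic_addl_image.
have mh := padic_addl_measurable (- h).
have [m mE] := exists_pushforward mu mh.
rewrite -mE; apply: padic_measure_unique => //.
  rewrite mE preimage_setT; apply: (@le_lt_trans _ _ 1%E); rewrite ?ltry//.
  exact: probability_le1.
move=> n c; rewrite mE [RHS]muE law_cyl.
rewrite (_ : _ @^-1` _ = cyl n (h + c)); last first.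
  apply/seteqP; split => x /=; rewrite !cylE => E.
    by rewrite -(addNKr h x) [LHS]psumD E [RHS]psumD.
  by rewrite psumD E -psumD addKr.
transitivity (P (phiU @^-1` cyl n (h + c))); first exact: muE.
rewrite law_cyl; congr EFin; apply: eq_bigr => j _; rewrite /digit_mass.
case: ifPn => // jr; suff -> : (h + c) j = c j by [].
by move: (nat_of_ord j) jr; apply/psum_inj/Lambda_sub; rewrite addrK.
Qed.

Lemma law_of_phi (a : Delta) : is_levy_measure eta ->
  has_law P (fun t => phi p_pr (fun j => U j t + Posz (a j) + Y j t))
    (padic_convolution
      (padic_convolution (haar_measure R (Lambda p_pr r)) (\d_a))
      (generalized_poisson eta)).
Proof.
move=> eta_levy; have [_ _ _ rowlaw] := adm.
have [FU FUE] := exists_mfun mphiU; have [FY FYE] := exists_mfun mphiY.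
pose muU : probability Delta R := distribution P FU.
pose muY : probability Delta R := distribution P FY.
have muUE A : muU A = P (phiU @^-1` A) by rewrite -FUE.
have muYE A : muY A = P (phiY @^-1` A) by rewrite -FYE.
have haarE A : measurable A -> haar_measure R (Lambda p_pr r) A = muU A.
  move=> mA; apply: (normalized_haar_unique (H := Lambda p_pr r)) => //.
  - exact: (@measurable_Lambda p p_pr r).
  - exact: LambdaN.
  - apply: (xgetPex (\d_(0 : Delta) : probability Delta R)).
    by exists muU; exact: law_haar.
  - exact: law_haar.
have muY_poisson : is_generalized_poisson eta muY.
  apply: row_law_generalized_poisson => // n m.
  have [_ <-//] := rowlaw n; rewrite muYE; congr (P _).
  by apply/seteqP; split => t /=; rewrite (row_residue_phi p_pr n (fun j => Y j t)).
have poissonE A : measurable A -> generalized_poisson eta A = muY A.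
  apply: fourier_unique => chi chiP; rewrite (muY_poisson _ chiP).
  suff /(_ chi chiP) -> : is_generalized_poisson eta (generalized_poisson eta) by [].
  by apply: (xgetPex (\d_(0 : Delta) : probability Delta R)); exists muY.
have phiE t : phi p_pr (fun j => U j t + Posz (a j) + Y j t) = phiU t + a + phiY t.
  rewrite (phiD p_pr (fun j => U j t + Posz (a j)) (fun j => Y j t)).
  by rewrite (phiD p_pr (fun j => U j t) (fun j => Posz (a j))) phi_digits.
have mphiUa : measurable_fun setT (fun t => phiU t + a).
  rewrite (_ : (fun t => _) = (fun x => a + x) \o phiU).
    by apply: measurableT_comp => //; exact: padic_addl_measurable.
  by apply/funext => t /=; rewrite addrC.
have [FV FVE] := exists_mfun mphiUa.
pose muV : probability Delta R := distribution P FV.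
have muVE A : muV A = P ((fun t => phiU t + a) @^-1` A) by rewrite -FVE.
have mpair : measurable_fun setT (fun t => (phiU t + a, phiY t)).
  exact: measurable_fun_pair.
rewrite (_ : (fun t => _) = (fun z : Delta * Delta => z.1 + z.2) \o
    (fun t => (phiU t + a, phiY t))); last exact/funext.
split; first by apply: measurableT_comp => //; exact: measurable_padic_add.
move=> A mA; have madd : measurable ((fun z : Delta * Delta => z.1 + z.2) @^-1` A).
  by rewrite -[X in measurable X]setTI; exact: measurable_padic_add.
have shift (B : set Delta) : measurable B -> measurable [set x : Delta | B (x + a)].
  move=> mB; rewrite (_ : [set x | _] = (fun x => a + x) @^-1` B).
    by rewrite -[X in measurable X]setTI; exact: padic_addl_measurable.
  by apply/seteqP; split => x /=; rewrite addrC.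
have convE (B : set Delta) : measurable B ->
    padic_convolution (haar_measure R (Lambda p_pr r)) (\d_a) B = muV B.
  move=> mB; rewrite /padic_convolution /convolution /pushforward /product_measure1.
  transitivity (\int[haar_measure R (Lambda p_pr r)]_x
      (\1_[set x : Delta | B (x + a)] x)%:E)%E.
    apply: eq_integral => x _ /=; rewrite xsectionE /= diracE indicE.
    by congr ((nat_of_bool _)%:R%:E); apply/idP/idP; rewrite !inE.
  rewrite integral_indic ?setIT//; last exact: shift.
  rewrite muVE -[RHS](muUE [set x : Delta | B (x + a)]).
  by apply: haarE; exact: shift.
(* The inner convolution is a bare set function; as a measure it can be exchanged for [muV] under
   the integral. *)
have [conv convmE] := exists_pushforward
  (haar_measure R (Lambda p_pr r) \x \d_a)%E (@measurable_padic_add p p_pr).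
have convF : padic_convolution (haar_measure R (Lambda p_pr r)) (\d_a) = conv.
  by apply/funext => B; rewrite convmE.
rewrite -[RHS]/(\int[padic_convolution (haar_measure R (Lambda p_pr r)) (\d_a)]_x
  (generalized_poisson eta \o
    xsection ((fun z : Delta * Delta => (z.1 + z.2)%R) @^-1` A)) x)%E convF.
set S := _ @^-1` A in madd *.
transitivity (\int[muV]_x (muY \o xsection S) x)%E; last first.
  transitivity (\int[conv]_x (muY \o xsection S) x)%E.
    apply: eq_measure_integral => B mB _.
    by rewrite -convF; exact/esym/convE.
  apply: eq_integral => x _; rewrite /= poissonE//.
  exact: measurable_xsection.
have [m mE] := exists_pushforward P mpair.
transitivity (m ((fun z : Delta * Delta => z.1 + z.2) @^-1` A)).
  by rewrite mE.
symmetry.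
(* Independence, checked on rectangles, makes the joint law [m] the product of [muV] and [muY]. *)
apply: product_measure_unique => // B C mB mC.
by rewrite mE -[RHS]/(muV B * muY C)%E muVE muYE -(indep_phi (shift _ mB) mC).
Qed.

End Admissible.
End Law.

Theorem theorem4p1 (R : realType) (p : nat) (p_pr : prime p) (r : nat)
    (a : padic p_pr) (eta : {measure set (padic p_pr) -> \bar R})
    (eta_levy : is_levy_measure eta) :
  (exists (d : measure_display) (T : measurableType d) (P : probability T R)
     (U Y : nat -> {RV P >-> int}), admissible r eta U Y)
  /\
  (forall (d : measure_display) (T : measurableType d) (P : probability T R)
     (U Y : nat -> {RV P >-> int}), admissible r eta U Y ->
     has_law P (fun t => phi p_pr (fun j => U j t + Posz (a j) + Y j t))
       (padic_convolution
          (padic_convolution (haar_measure R (Lambda p_pr r)) (\d_a))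
          (generalized_poisson eta))).
Proof.
split; first exact: admissible_exists.
by move=> d T P U Y adm; exact: law_of_phi.
Qed.
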